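(* Let $\mathcal{D}$ be a distribution over samples $(\bm{x},y)$, $\ell(\bm{w},\bm{x},y)$ a loss differentiable in $\bm{w}$, and let $\mathcal{W}\subset\mathbb{R}^d$ be a bounded convex set with diameter $D_{\mathcal{W}}<\infty$. Suppose there is a function $G(\bm{x},y)\ge0$ with $\|\nabla_{\bm{w}}\ell(\bm{w},\bm{x},y)\|\le G(\bm{x},y)$ for all $\bm{w}\in\mathcal{W}$ and all $(\bm{x},y)$ in the support of $\mathcal{D}$, and that for some $k>1$ and $G>0$, $\left(\mathbb{E}_{(\bm{x},y)\sim\mathcal{D}}[G(\bm{x},y)^k]\right)^{1/k}\le G$. Let $\mathcal{Z}=\{(\bm{x}_i,y_i)\}_{i=1}^n$ be i.i.d. from $\mathcal{D}$, $f_i(\bm{w})=\ell(\bm{w},\bm{x}_i,y_i)$, $f=\frac1n\sum_if_i$, and suppose $f$ is convex. Fix $\gamma\in(0,1)$ and $T\ge1$, and run DP-SGD over $\mathcal{W}$ with $\tau=\frac{G}{\gamma^{1/k}}\left(\frac1T+\varphi^2\right)^{-\frac1{2k}}$, $\eta_t=\eta=\frac{D_{\mathcal{W}}}{T\tau}\left(\frac1T+\varphi^2\right)^{-\frac12}$ for all $t<T$, and $\sigma_n^2=\frac{\nu T\log(1/\delta)\tau^2}{n^2\varepsilon^2}$. Then with probability at least $1-\gamma$ over the random dataset $\mathcal{Z}$, $$\mathrm{OR}(T)\le\frac{5D_{\mathcal{W}}G}{2\gamma^{1/k}}\left(\frac1T+\varphi^2\right)^{\frac12(1-\frac1k)}.$$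 In particular, for $T=\frac1{\varphi^2}$, $\mathrm{OR}(T)\le\frac{5D_{\mathcal{W}}G}{2^{\frac12(1+\frac1k)}\gamma^{1/k}}\varphi^{1-\frac1k}$.
   Context: For $\bm{z}\in\mathbb{R}^d$ and $c>0$, $\mathrm{clip}(\bm{z},c)=\bm{z}\min(1,c/\|\bm{z}\|)$ ($\|\cdot\|$ Euclidean). DP-SGD on $f=\frac1n\sum_if_i$ over $\mathcal{W}$: given $\bm{w}_0\in\mathcal{W}$, $T$, step sizes $\eta_t$, a parameter $b\ge1$, clip norm $\tau$, noise variance $\sigma_n^2$: for $t=0,\dots,T-1$, form $\mathcal{S}_t\subseteq[n]$ by including each index independently with probability $b/n$; $\bm{g}_t=\frac1b\sum_{i\in\mathcal{S}_t}\mathrm{clip}(\nabla f_i(\bm{w}_t),\tau)+\bm{\zeta}_t$, $\bm{\zeta}_t\sim\mathcal{N}(\bm{0},\sigma_n^2I_d)$ independent; $\bm{w}_{t+1}=\Pi_{\mathcal{W}}(\bm{w}_t-\eta_t\bm{g}_t)$ (Euclidean projection). Output $\bm{w}_{\mathrm{priv}}=\bm{w}_{\widehat t}$, $\widehat t$ uniform on $\{0,\dots,T-1\}$. Here $\varepsilon>0$, $\delta\in(0,1)$, $\nu>0$ a fixed absolute constant, $\varphi=\frac{\sqrt{\nu d\log(1/\delta)}}{n\varepsilon}$. The optimization risk is $\mathrm{OR}(T)=\mathbb{E}[f(\bm{w}_{\mathrm{priv}})]-f(\bm{w}^* )$ with $\bm{w}^*\in\arg\min_{\bm{w}\in\mathcal{W}}f(\bm{w})$,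 the expectation being over the algorithm's randomness conditional on $\mathcal{Z}$. *)

(* Defs.v *)
From HB Require Import structures.
From mathcomp Require Import all_boot all_order all_algebra.
From mathcomp Require Import all_classical all_reals all_analysis.
Set Implicit Arguments. Unset Strict Implicit. Unset Printing Implicit Defensive.
Import Order.TTheory GRing.Theory Num.Theory.
Import numFieldNormedType.Exports.
Local Open Scope classical_set_scope.
Local Open Scope ring_scope.

Section defs.
Context {R : realType}.

Definition enorm {d : nat} (v : 'rV[R]_d) : R :=
  Num.sqrt (\sum_(i < d) v ord0 i ^+ 2).

Definition clip {d : nat} (z : 'rV[R]_d) (c : R) : 'rV[R]_d :=
  Num.min 1 (c / enorm z) *: z.

Definition grad {d : nat} (f : 'rV[R]_d -> R) (w : 'rV[R]_d) : 'rV[R]_d :=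
  \row_(i < d) ('d f w (delta_mx ord0 i : 'rV[R]_d)).

Definition is_euclid_proj {d : nat} (W : set 'rV[R]_d)
    (Pi : 'rV[R]_d -> 'rV[R]_d) :=
  forall v, W (Pi v) /\ forall u, W u -> enorm (v - Pi v) <= enorm (v - u).

Definition diam {d : nat} (W : set 'rV[R]_d) : R :=
  sup [set r | exists x y, W x /\ W y /\ r = enorm (x - y)].

Definition bounded_euclid {d : nat} (W : set 'rV[R]_d) :=
  exists M : R, forall x y, W x -> W y -> enorm (x - y) <= M.

(* Mutual independence of a finite family of random elements with values
   in a common measurable space: product rule for every choice of
   measurable sets (taking B j = setT recovers every subfamily). *)
Definition mutually_independent {dO : measure_display} {O : measurableType dO}
    (P : probability O R) {J : finType} {dT : measure_display}
    {T : measurableType dT} (X : J -> O -> T) :=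
  (forall j, measurable_fun setT (X j)) /\
  forall B : J -> set T, (forall j, measurable (B j)) ->
    P (\bigcap_j (X j @^-1` B j)) = (\prod_(j : J) P (X j @^-1` B j))%E.

(* DP-SGD iterates w_t, given the per-sample gradients, the projection,
   the realized subsampling (incl t i = [i \in S_t]) and noise zeta t. *)
Fixpoint dpsgd_iter {n d : nat} (gradi : 'I_n -> 'rV[R]_d -> 'rV[R]_d)
    (Pi : 'rV[R]_d -> 'rV[R]_d) (w0 : 'rV[R]_d) (eta : nat -> R) (b tau : R)
    (incl : nat -> 'I_n -> bool) (zeta : nat -> 'rV[R]_d) (t : nat)
    : 'rV[R]_d :=
  match t with
  | 0 => w0
  | s.+1 =>
      let w := dpsgd_iter gradi Pi w0 eta b tau incl zeta s in
      let g := b^-1 *: (\sum_(i < n | incl s i) clip (gradi i w) tau) + zeta s in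
      Pi (w - eta s *: g)
  end.

(* Index set of the algorithm's elementary random variables:
   inclusion indicators (t,i), noise coordinates (t,j), and the output index. *)
Definition alg_index (T n d : nat) : finType :=
  (('I_T * 'I_n) + ('I_T * 'I_d) + unit)%type.

Definition alg_family {dO : measure_display} {O : measurableType dO}
    (T n d : nat) (X : nat -> 'I_n -> O -> R) (N : nat -> 'I_d -> O -> R)
    (U : O -> R) (j : alg_index T n d) : O -> R :=
  match j with
  | inl (inl (t, i)) => X (val t) i
  | inl (inr (t, k)) => N (val t) k
  | inr _ => U
  end.

(* The DP-SGD output w_priv = w_{hat t} as a function of the algorithm's
   randomness omega: S_t = {i | X t i omega = 1}, zeta_t = (N t j omega)_j,
   hat t = truncn (U omega). *)
Definition dpsgd_output {dO : measure_display} {O : measurableType dO}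
    {n d : nat} (gradi : 'I_n -> 'rV[R]_d -> 'rV[R]_d)
    (Pi : 'rV[R]_d -> 'rV[R]_d) (w0 : 'rV[R]_d) (eta : nat -> R) (b tau : R)
    (X : nat -> 'I_n -> O -> R) (N : nat -> 'I_d -> O -> R) (U : O -> R)
    (omega : O) : 'rV[R]_d :=
  dpsgd_iter gradi Pi w0 eta b tau (fun t i => X t i omega == 1)
    (fun t => \row_(j < d) N t j omega) (Num.truncn (U omega)).

Definition OR_le {dO : measure_display} {O : measurableType dO}
    (P : probability O R) {d : nat} (W : set 'rV[R]_d) (f : 'rV[R]_d -> R)
    (wpriv : O -> 'rV[R]_d) (bound : R) :=
  forall wstar, W wstar -> (forall w, W w -> f wstar <= f w) ->
    (\int[P]_omega (f (wpriv omega))%:E - (f wstar)%:E <= bound%:E)%E.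

End defs.

(* Main.v *)
Require Import Defs.
From HB Require Import structures.
From mathcomp Require Import all_boot all_order all_algebra ring lra.
From mathcomp Require Import all_classical all_reals all_analysis.
From mathcomp Require Import measurable_realfun.
Import Order.TTheory GRing.Theory Num.Theory.
Import numFieldNormedType.Exports.
Set Implicit Arguments. Unset Strict Implicit. Unset Printing Implicit Defensive.
Local Open Scope classical_set_scope.
Local Open Scope ring_scope.

(** By Markov's inequality, with probability at least [1 - gamma] all samples
    lie in the support and the empirical k-th moment of the envelope is at most
    [G^k / gamma]. On that event clipping at [tau] moves the full gradient by at
    most [G^k / (gamma tau^(k-1))], since [x <= x^k / tau^(k-1)] for
    [x > tau]. For a fixed dataset, projected SGD is analysed by expanding
    [|w_(t+1) - w*|^2]: the subsampling and the noise of step [t] are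
    independent of [w_t], so the cross term has expectation
    [<clipped full gradient, w_t - w*>] and
    [E|g_t|^2 <= tau^2 + tau^2 / b + d sigma_n^2]. Telescoping, first-order
    convexity and the independence of the output index bound the risk by
    [D^2/(2 T eta) + eta/2 (2 tau^2 + d sigma_n^2) + D G^k/(gamma tau^(k-1))];
    with [q = (1/T + phi^2)^(1/2)] the three terms are at most
    [D tau q / 2], [D tau q] and [D tau q]. *)

(** * Euclidean geometry and gradients *)

Section euclid.
Context {R : realType} {d : nat}.
Implicit Types (u v w : 'rV[R]_d) (W : set 'rV[R]_d).

(** The algorithm's randomness is given only as one finite, mutually independent family of real
    variables, while each iterate is a nonlinear function of a growing subfamily. Every use of
    independence therefore goes through sigma-algebras generated by subsets of the index set:
    variables measurable for disjoint subsets are independent. This in turn requires that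
    projection, gradient and clipping preserve measurability, which comes from nonexpansiveness,
    from difference quotients and from real powers.

    The parameters balance the error terms. [tau] solves [tau^k q = G^k / gamma], so the clipping
    bias is exactly [D tau q]; [eta] equals [D / (T tau q)]; and [phi] is such that
    [d sigma_n^2 = T phi^2 tau^2], so that [q^2 = 1/T + phi^2] absorbs the sampling and the noise
    parts of the second moment together.

    The event of probability [1 - gamma] concerns the dataset alone, so one event serves all
    minimizers and both forms of the bound. *)

Definition dotp u v : R := \sum_(i < d) u ord0 i * v ord0 i.

Lemma dotpC u v : dotp u v = dotp v u.
Proof. by apply: eq_bigr => i _; rewrite mulrC. Qed.

Lemma dotpDl u v w : dotp (u + v) w = dotp u w + dotp v w.
Proof.
by rewrite /dotp -big_split; apply: eq_bigr => i _; rewrite mxE mulrDl.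
Qed.

Lemma dotpZl (a : R) u v : dotp (a *: u) v = a * dotp u v.
Proof. by rewrite /dotp mulr_sumr; apply: eq_bigr => i _; rewrite mxE mulrA. Qed.

Lemma dotpNl u v : dotp (- u) v = - dotp u v.
Proof. by rewrite -scaleN1r dotpZl mulN1r. Qed.

Lemma dotpBl u v w : dotp (u - v) w = dotp u w - dotp v w.
Proof. by rewrite dotpDl dotpNl. Qed.

Lemma dotpDr u v w : dotp u (v + w) = dotp u v + dotp u w.
Proof. by rewrite !(dotpC u) dotpDl. Qed.

Lemma dotpZr (a : R) u v : dotp u (a *: v) = a * dotp u v.
Proof. by rewrite !(dotpC u) dotpZl. Qed.

Lemma dotpNr u v : dotp u (- v) = - dotp u v.
Proof. by rewrite !(dotpC u) dotpNl. Qed.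

Lemma dotpBr u v w : dotp u (v - w) = dotp u v - dotp u w.
Proof. by rewrite !(dotpC u) dotpBl. Qed.

Lemma dotp_suml (I : finType) (P : pred I) (F : I -> 'rV[R]_d) v :
  dotp (\sum_(i | P i) F i) v = \sum_(i | P i) dotp (F i) v.
Proof.
rewrite /dotp exchange_big /=; apply: eq_bigr => i _.
by rewrite summxE mulr_suml.
Qed.

Lemma dotpvv_ge0 u : 0 <= dotp u u.
Proof. by apply: sumr_ge0 => i _; rewrite -expr2 sqr_ge0. Qed.

Lemma enorm_sqr u : enorm u ^+ 2 = dotp u u.
Proof.
rewrite /enorm sqr_sqrtr; first by apply: eq_bigr => i _; rewrite expr2.
by apply: sumr_ge0 => i _; rewrite sqr_ge0.
Qed.

Lemma enormE u : enorm u = Num.sqrt (dotp u u).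
Proof. by rewrite -enorm_sqr sqrtr_sqr ger0_norm// sqrtr_ge0. Qed.

Lemma enorm_ge0 u : 0 <= enorm u.
Proof. exact: sqrtr_ge0. Qed.

Lemma enorm_eq0 u : enorm u = 0 -> u = 0.
Proof.
move=> u0; have : dotp u u = 0 by rewrite -enorm_sqr u0 expr0n.
move=> /eqP; rewrite psumr_eq0 => [/allP h|i _]; last by rewrite -expr2 sqr_ge0.
apply/rowP => i; rewrite mxE; apply/eqP.
have /= := h i (mem_index_enum i).
by rewrite -expr2 sqrf_eq0.
Qed.

Lemma enorm0 : enorm (0 : 'rV[R]_d) = 0.
Proof.
rewrite enormE /dotp big1 ?sqrtr0// => i _; by rewrite mxE mul0r.
Qed.

Lemma enormZ (a : R) u : enorm (a *: u) = `|a| * enorm u.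
Proof.
by rewrite !enormE dotpZl dotpZr mulrA -expr2 sqrtrM ?sqr_ge0// sqrtr_sqr.
Qed.

Lemma enormN u : enorm (- u) = enorm u.
Proof. by rewrite -scaleN1r enormZ normrN1 mul1r. Qed.

Lemma enormBC u v : enorm (u - v) = enorm (v - u).
Proof. by rewrite -enormN opprB. Qed.

(** Cauchy-Schwarz: with [a], [b] the norms and [c] the inner product, the squared norm of
    [enorm v *: u - enorm u *: v] is [2ab(ab - c)]. *)
Lemma dotp_le u v : dotp u v <= enorm u * enorm v.
Proof.
have [->|v0] := eqVneq v 0.
  by rewrite enorm0 mulr0 /dotp big1// => i _; rewrite mxE mulr0.
have nv : 0 < enorm v.
  rewrite lt_neqAle enorm_ge0 andbT eq_sym; apply: contra v0 => /eqP e.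
  by rewrite (enorm_eq0 e).
have [u0|u0] := eqVneq (enorm u) 0.
  rewrite u0 mul0r (enorm_eq0 u0) /dotp big1// => i _; by rewrite mxE mul0r.
have nu : 0 < enorm u by rewrite lt_neqAle enorm_ge0 andbT eq_sym.
have := dotpvv_ge0 (enorm v *: u - enorm u *: v).
rewrite !(dotpBl, dotpBr, dotpZl, dotpZr) -!enorm_sqr (dotpC v u).
set a := enorm u in nu *; set b := enorm v in nv *; set c := dotp u v.
have ab : 0 < a * b by rewrite mulr_gt0.
move=> h; have : 0 <= (2 * (a * b)) * (a * b - c) by nra.
by rewrite pmulr_rge0 ?mulr_gt0// subr_ge0.
Qed.

Lemma coord_le_enorm u j : `|u ord0 j| <= enorm u.
Proof.
rewrite -sqrtr_sqr enormE ler_wsqrtr// /dotp (bigD1 j)//= -expr2 lerDl.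
by apply: sumr_ge0 => i _; rewrite -expr2 sqr_ge0.
Qed.

(** The topology of ['rV[R]_d] comes from the sup norm; this crude comparison is enough to transfer
    continuity. *)
Lemma enorm_le_mx_norm u : enorm u <= d%:R * `|u|.
Proof.
have h j : `|u ord0 j| <= `|u|.
  rewrite -[X in _ <= X]/(mx_norm u) mx_normrE; exact: (le_bigmax _ (fun i => `|u i.1 i.2|) (ord0, j)).
rewrite -(@ler_pXn2r _ 2)// ?nnegrE ?mulr_ge0 ?enorm_ge0//.
rewrite enorm_sqr exprMn; apply: (@le_trans _ _ (\sum_(i < d) `|u| ^+ 2)).
  by apply: ler_sum => i _; rewrite -expr2 -real_normK ?num_real// lerXn2r ?nnegrE.
rewrite sumr_const card_ord -[X in X <= _]mulr_natl ler_wpM2r ?sqr_ge0//.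
rewrite -natrX ler_nat; case: (d) => // m; exact: leq_pmulr.
Qed.

Lemma enormB_sqr u v : enorm (u - v) ^+ 2 = enorm u ^+ 2 - 2 * dotp u v + enorm v ^+ 2.
Proof. by rewrite !enorm_sqr dotpBl !dotpBr (dotpC v u); ring. Qed.

Lemma enorm_clip u (c : R) : 0 <= c -> enorm (clip u c) <= c.
Proof.
move=> c0; rewrite /clip enormZ.
have [u0|u0] := eqVneq (enorm u) 0; first by rewrite u0 mulr0.
have nu : 0 < enorm u by rewrite lt_neqAle enorm_ge0 andbT eq_sym.
rewrite ger0_norm; last by rewrite le_min ler01 divr_ge0// enorm_ge0.
by rewrite -ler_pdivlMr// ge_min lexx orbT.
Qed.

(** Stated with an upper bound [g] instead of [enorm u], because it is the envelope that is uniform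
    over iterates and has a controlled moment. When clipping acts, the error [enorm u - c] is at
    most [g], and [c <= g] allows [g = g^k / g^(k-1)] to be bounded. *)
Lemma enorm_sub_clip u (c k g : R) : 0 < c -> 1 < k -> enorm u <= g ->
  enorm (u - clip u c) <= g `^ k / c `^ (k - 1).
Proof.
move=> c0 k1 ug.
have g0 : 0 <= g by apply: le_trans ug; exact: enorm_ge0.
have [u0|u0] := eqVneq (enorm u) 0.
  by rewrite (enorm_eq0 u0) /clip scaler0 subr0 enorm0 divr_ge0// powR_ge0.
have nu : 0 < enorm u by rewrite lt_neqAle enorm_ge0 andbT eq_sym.
rewrite /clip; have [uc|cu] := leP (enorm u) c.
  rewrite min_l; last by rewrite ler_pdivlMr// mul1r.
  by rewrite scale1r subrr enorm0 divr_ge0// powR_ge0.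
rewrite min_r; last by rewrite ler_pdivrMr// mul1r ltW.
apply: (@le_trans _ _ g).
  rewrite -[X in X - _]scale1r -scalerBl enormZ ger0_norm; last first.
    by rewrite subr_ge0 ler_pdivrMr// mul1r ltW.
  rewrite mulrBl mul1r mulfVK//; lra.
have cg : c <= g by rewrite (le_trans _ ug)// ltW.
rewrite ler_pdivlMr ?powR_gt0//.
have gp : 0 < g by apply: lt_le_trans cg.
rewrite (_ : g `^ k = g * g `^ (k - 1)); last first.
  transitivity (g `^ (1 + (k - 1))); first by congr (_ `^ _); ring.
  set e := k - 1.
  by rewrite powRD ?powRr1// (gt_eqF gp) implybT.
rewrite ler_wpM2l// ge0_ler_powR// ?nnegrE ?ltW//; lra.
Qed.

Lemma le_diam W u v : bounded_euclid W -> W u -> W v -> enorm (u - v) <= diam W.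
Proof.
move=> [M hM] Wu Wv; apply: ub_le_sup; last by exists u, v.
by exists M => _ [x [y [Wx [Wy ->]]]]; exact: hM.
Qed.

End euclid.

(** * Euclidean projection onto a convex set *)

Section projection.
Context {R : realType} {d : nat}.
Variables (W : set 'rV[R]_d) (Pi : 'rV[R]_d -> 'rV[R]_d).
Hypotheses (Wconv : convex_set (W : set (convex_lmodType 'rV[R]_d)))
  (PiW : is_euclid_proj W Pi).
Implicit Types u v w : 'rV[R]_d.

Lemma convex_set_segment u v (t : R) : 0 <= t <= 1 -> W u -> W v ->
  W (v + t *: (u - v)).
Proof.
move=> /andP[t0 t1] Wu Wv.
have t01 : Itv.spec (@Itv.num_sem R) (Itv.Real `[0%Z, 1%Z]) t.
  by rewrite /= /Itv.num_sem/= num_real/= in_itv/= t0 t1.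
have := @Wconv u v (Itv.mk t01); rewrite !inE => /(_ Wu Wv).
rewrite /conv/= /unstable.onem; congr W.
by rewrite scalerBl scale1r scalerBr addrCA addrC -addrA.
Qed.

(** Moving from [Pi v] towards [u] stays in [W] and cannot bring the point closer to [v]; comparing
    first and second order terms in the step length [t] excludes an acute angle. *)
Lemma proj_obtuse v u : W u -> dotp (v - Pi v) (u - Pi v) <= 0.
Proof.
move=> Wu; have [WPv Pmin] := PiW v.
set a := v - Pi v; set e := u - Pi v; rewrite leNgt; apply/negP => c0.
have key t : 0 <= t <= 1 -> 2 * t * dotp a e <= t ^+ 2 * dotp e e.
  move=> t01; have := Pmin _ (convex_set_segment t01 Wu WPv).
  rewrite -/e opprD addrA -/a => le1.
  have {le1} : enorm a ^+ 2 <= enorm (a - t *: e) ^+ 2.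
    by rewrite ler_pXn2r// nnegrE enorm_ge0.
  rewrite (enormB_sqr a (t *: e)) !enorm_sqr dotpZr dotpZl dotpZr; lra.
have e0 := dotpvv_ge0 e.
(* This [t] gives [t |e|^2 < <a, e>], which contradicts [2 <a, e> <= t |e|^2]; the added 1 keeps the
   denominator positive. *)
pose t := Num.min 1 (dotp a e / (dotp e e + 1)).
have t0 : 0 < t by rewrite lt_min ltr01 divr_gt0//; lra.
have t1 : t <= 1 by rewrite ge_min lexx.
have tle : t * (dotp e e + 1) <= dotp a e.
  by rewrite -ler_pdivlMr ?ge_min ?lexx ?orbT//; lra.
have := key t; rewrite (ltW t0) t1 => /(_ isT).
rewrite (_ : 2 * t * dotp a e = t * (2 * dotp a e)); last by ring.
rewrite expr2 -mulrA ler_pM2l//; nra.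
Qed.

Lemma proj_closer v u : W u -> enorm (Pi v - u) ^+ 2 <= enorm (v - u) ^+ 2.
Proof.
move=> Wu; have := proj_obtuse v Wu.
rewrite (_ : v - u = (v - Pi v) - (u - Pi v)); last by rewrite opprB addrA subrK.
rewrite [X in _ -> _ <= X]enormB_sqr (enormBC (Pi v)).
have := sqr_ge0 (enorm (v - Pi v)); lra.
Qed.

(** Sum of the obtuse-angle inequalities at [u] and at [v]. It serves to make the projection
    continuous, hence the iterates measurable. *)
Lemma proj_nonexpansive u v : enorm (Pi u - Pi v) <= enorm (u - v).
Proof.
have h1 := proj_obtuse u (PiW v).1; have h2 := proj_obtuse v (PiW u).1.
rewrite -(@ler_pXn2r _ 2)// ?nnegrE ?enorm_ge0//.
rewrite (_ : u - v = (Pi u - Pi v) - ((v - Pi v) - (u - Pi u))); last first.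
  by apply/rowP => j; rewrite !mxE; ring.
rewrite [leRHS]enormB_sqr.
have : dotp (Pi u - Pi v) ((v - Pi v) - (u - Pi u)) <= 0.
  rewrite dotpBr dotpC.
  have -> : dotp (Pi u - Pi v) (u - Pi u) = - dotp (u - Pi u) (Pi v - Pi u).
    by rewrite dotpC -dotpNr opprB.
  lra.
have := sqr_ge0 (enorm (v - Pi v - (u - Pi u))); lra.
Qed.

Lemma continuous_proj_coord j : continuous (fun v => Pi v ord0 j).
Proof.
move=> v; apply/(@cvgrPdist_lt _ _ _ (nbhs v) _) => e e0.
near=> u.
apply: (@le_lt_trans _ _ (d%:R * `|v - u|)).
  apply: le_trans (enorm_le_mx_norm _); apply: le_trans (proj_nonexpansive _ _).
  by apply: le_trans (coord_le_enorm _ j); rewrite !mxE.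
(* Passing to [d.+1] makes the factor positive even when [d = 0], so that it can be divided out. *)
apply: (@le_lt_trans _ _ ((d.+1)%:R * `|v - u|)).
  by rewrite ler_wpM2r// ler_nat.
rewrite mulrC -ltr_pdivlMr//; near: u; apply: cvgr_dist_lt => //.
by rewrite divr_gt0.
Unshelve. all: by end_near. Qed.

End projection.

(** * Gradients of averages and first-order convexity *)

Section gradient.
Context {R : realType} {d : nat}.
Implicit Types (f : 'rV[R]_d -> R) (u v w : 'rV[R]_d).

Lemma diff_grad f w v : differentiable f w -> 'd f w v = dotp (grad f w) v.
Proof.
move=> df; rewrite {1}(row_sum_delta v) linear_sum; apply: eq_bigr => i _.
by rewrite linearZ/= mxE mulrC.
Qed.

Lemma grad_mean (n : nat) (F : 'I_n -> 'rV[R]_d -> R) (a : R) w :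
  (forall i, differentiable (F i) w) ->
  grad (fun w => a * \sum_i F i w) w = a *: \sum_i grad (F i) w.
Proof.
move=> dF; apply/rowP => j; rewrite !mxE summxE.
have -> : (fun w => a * \sum_i F i w) = a *: \sum_i F i.
  by apply/funext => x; rewrite /= fct_sumE.
have dS : differentiable (\sum_i F i) w by exact: differentiable_sum.
rewrite -deriveE; last exact: differentiableZ.
rewrite deriveZ; last exact: diff_derivable.
rewrite derive_sum; last by move=> i; exact: diff_derivable.
by congr (_ * _); apply: eq_bigr => i _; rewrite mxE deriveE.
Qed.

(** The derivative along [u - w] is computed as a limit from the right, because convexity bounds the
    difference quotient by [f u - f w] for [0 < h <= 1]. *)
Lemma convex_first_order (W : set 'rV[R]_d) f u w :
  convex_function (W : set (convex_lmodType 'rV[R]_d)) f ->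
  differentiable f w -> W u -> W w -> f w - f u <= dotp (grad f w) (w - u).
Proof.
move=> fconv df Wu Ww.
rewrite -lerN2 opprB -dotpNr opprB -diff_grad// -deriveE//.
have dv : derivable f w (u - w) by exact: diff_derivable.
rewrite /derive.
set L := lim _.
have cv : (fun h => h^-1 *: (f (h *: (u - w) + w) - f w)) @ 0^'+ --> (L : R^o).
  by apply: cvg_dnbhs_at_right; exact: dv.
rewrite -(cvg_lim _ cv)//; apply: limr_le; first exact: cvgP cv.
near=> h.
have h0 : 0 < h by near: h; exact: nbhs_right_gt.
have h1 : h <= 1 by near: h; exact: nbhs_right_le.
have h01 : Itv.spec (@Itv.num_sem R) (Itv.Real `[0%Z, 1%Z]) h.
  by rewrite /= /Itv.num_sem/= num_real/= in_itv/= (ltW h0) h1.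
have := @fconv (Itv.mk h01) u w; rewrite !inE => /(_ Wu Ww).
rewrite /conv/= /unstable.onem.
have -> : h *: u + (1 - h) *: w = h *: (u - w) + w.
  by rewrite scalerBl scale1r scalerBr addrAC addrA.
move=> le1; rewrite [X in X <= _](_ : _ = h^-1 * (f (h *: (u - w) + w) - f w))//.
rewrite mulrC ler_pdivrMr// lerBlDr; apply: le_trans le1 _.
rewrite [X in X <= _](_ : _ = h * f u + (1 - h) * f w)//; lra.
Unshelve. all: by end_near. Qed.

End gradient.

(** * Measurability of random vectors *)

Section vector_measurability.
Context {R : realType} {d : nat} {dT : measure_display} {T : measurableType dT}.
Implicit Types (w : T -> 'rV[R]_d).

Definition measurable_vec w :=
  forall j, measurable_fun setT (fun x => w x ord0 j).

Let grid (m : nat) (v : 'rV[R]_d) : 'rV[int]_d :=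
  \row_j Num.floor (v ord0 j * m.+1%:R).

Let ungrid (m : nat) (z : 'rV[int]_d) : 'rV[R]_d :=
  \row_j ((z ord0 j)%:~R / m.+1%:R).

(** The set [B] is arbitrary: it is a countable union of points, and the preimage of a point is a
    finite intersection of preimages of half-open intervals. *)
Let measurable_grid m w (B : set 'rV[int]_d) : measurable_vec w ->
  measurable [set x | B (grid m (w x))].
Proof.
move=> mw.
have -> : [set x | B (grid m (w x))] =
    \bigcup_(z : 'rV[int]_d) [set x | B z /\ forall j, (grid m (w x)) ord0 j = z ord0 j].
  apply/seteqP; split => x /=; first by exists (grid m (w x)).
  by move=> [z _ [Bz /rowP e]]; rewrite e.
apply: countable_bigcupT_measurable; first exact: countableP.
move=> z; have [Bz|nBz] := pselect (B z); last first.
  rewrite (_ : [set _ | _] = set0)//; apply/seteqP; split => // x /= [].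
  by move=> /nBz.
have -> : [set x | B z /\ forall j, (grid m (w x)) ord0 j = z ord0 j] =
    \bigcap_(j : 'I_d) ((fun x => w x ord0 j * m.+1%:R) @^-1`
      `[(z ord0 j)%:~R, (z ord0 j + 1)%:~R[).
  apply/seteqP; split => x /=.
    by move=> [_ h] j _ /=; rewrite in_itv/= -h mxE floor_itv.
  move=> h; split => // j; have /= := h j I; rewrite in_itv/= => hj.
  by rewrite mxE; exact: floor_def.
apply: fin_bigcap_measurable => // j _.
rewrite -[X in measurable X]setTI.
have mf : measurable_fun setT (fun x => w x ord0 j * m.+1%:R).
  by apply: measurable_funM => //; exact: mw.
exact: mf.
Qed.

Let grid_cvg (v : 'rV[R]_d) : ungrid m (grid m v) @[m --> \oo] --> v.
Proof.
apply/cvgrPdist_lt => e e0; near=> m.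
have me : m.+1%:R^-1 < e by near: m; exact: near_infty_natSinv_lt (PosNum e0).
apply: le_lt_trans me; rewrite -[X in X <= _]/(mx_norm _) mx_normrE.
apply: bigmax_le => // -[i j] _ /=; rewrite ord1 !mxE.
have /andP[h1 h2] := floor_itv (v ord0 j * m.+1%:R).
rewrite -[X in _ - X]mul1r -(ler_pM2r (ltr0Sn R m)) mulVf//.
rewrite -[X in _ * X]ger0_norm// -normrM mulrBl mul1r divfK//.
rewrite ger0_norm ?subr_ge0//; move: h2; rewrite intrD; lra.
Unshelve. all: by end_near. Qed.

(* 'rV[R]_d carries no Borel structure: continuous functions are approximated
   by their values on grids, which take countably many values. *)
Lemma measurable_vec_continuous (g : 'rV[R]_d -> R) w :
  continuous g -> measurable_vec w -> measurable_fun setT (g \o w).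
Proof.
move=> cg mw.
apply: (@measurable_fun_cvg _ _ _ _ (fun m => g \o ungrid m \o grid m \o w)).
- move=> m _ B mB; rewrite setTI.
  exact: (@measurable_grid m w [set z | B (g (ungrid m z))]).
- move=> x _; apply: continuous_cvg; first exact: cg.
  exact: grid_cvg.
Qed.

Lemma measurable_vecD u w : measurable_vec u -> measurable_vec w ->
  measurable_vec (fun x => u x + w x).
Proof.
move=> mu mw j; under eq_fun do rewrite mxE.
exact: measurable_funD.
Qed.

Lemma measurable_vec_cst (v : 'rV[R]_d) : measurable_vec (fun=> v).
Proof. by move=> j. Qed.

Lemma measurable_vecZ (a : T -> R) w : measurable_fun setT a ->
  measurable_vec w -> measurable_vec (fun x => a x *: w x).
Proof.
move=> ma mw j; under eq_fun do rewrite mxE.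
exact: measurable_funM.
Qed.

Lemma measurable_vec_sum (I : finType) (P : pred I) (F : I -> T -> 'rV[R]_d) :
  (forall i, P i -> measurable_vec (F i)) ->
  measurable_vec (fun x => \sum_(i | P i) F i x).
Proof.
move=> mF j; under eq_fun do rewrite summxE big_mkcond/=.
apply: measurable_sum => i; case: (boolP (P i)) => Pi; first exact: mF.
exact: measurable_cst.
Qed.

Lemma measurable_dotp u w : measurable_vec u -> measurable_vec w ->
  measurable_fun setT (fun x => dotp (u x) (w x)).
Proof.
move=> mu mw; rewrite /dotp; apply: measurable_sum => i.
exact: measurable_funM.
Qed.

Lemma measurable_enorm w : measurable_vec w ->
  measurable_fun setT (fun x => enorm (w x)).
Proof.
move=> mw; under eq_fun do rewrite enormE.
apply: (@measurableT_comp _ _ _ _ _ _ (@Num.sqrt R)).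
  by apply: continuous_measurable_fun; exact: sqrt_continuous.
exact: measurable_dotp.
Qed.

Lemma measurable_clip w (c : R) : measurable_vec w ->
  measurable_vec (fun x => clip (w x) c).
Proof.
move=> mw; apply: measurable_vecZ => //.
apply: measurable_minr => //; apply: measurable_funM => //.
(* Inversion is discontinuous at 0; on nonnegative norms it agrees with the power -1, which is
   measurable on the whole line. *)
rewrite (_ : (fun x => _) = (@powR R ^~ (-1)) \o (fun x => enorm (w x))); last first.
  by apply/funext => x; rewrite /= powR_inv1// enorm_ge0.
by apply: measurableT_comp; [exact: measurable_powR|exact: measurable_enorm].
Qed.

(** The gradient may be discontinuous, but each partial derivative is a pointwise limit of
    difference quotients with step [1/(m+1)], which are measurable since [f] is continuous. *)
Lemma measurable_grad (f : 'rV[R]_d -> R) w :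
  (forall v, differentiable f v) -> measurable_vec w ->
  measurable_vec (fun x => grad f (w x)).
Proof.
move=> df mw j; under eq_fun do rewrite mxE -deriveE//.
have cf : continuous f by move=> v; exact: differentiable_continuous.
pose e : 'rV[R]_d := delta_mx ord0 j.
apply: (@measurable_fun_cvg _ _ _ _
  (fun m x => m.+1%:R * (f (m.+1%:R^-1 *: e + w x) - f (w x)))).
- move=> m; apply: measurable_funM => //; apply: measurable_funB.
    apply: (measurable_vec_continuous cf).
    by apply: measurable_vecD => //; exact: measurable_vec_cst.
  exact: (measurable_vec_continuous cf).
- move=> x _.
  have dv : derivable f (w x) e by exact: diff_derivable.
  have : (fun m : nat => m.+1%:R^-1 : R) @ \oo --> 0^'.
    move=> A /= A0.
    have c0 : (fun m : nat => m.+1%:R^-1 : R) @ \oo --> (0 : R) by exact: cvg_harmonic.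
    have h : \forall m \near \oo, (m.+1%:R^-1 != 0 :> R) -> A (m.+1%:R^-1) := c0 _ A0.
    apply: filterS h => m; apply.
    by rewrite invr_eq0 pnatr_eq0.
  move=> h; have := cvg_comp _ _ h dv.
  rewrite /comp; under eq_fun do rewrite invrK.
  exact.
Qed.

End vector_measurability.

Lemma measurable_vec_proj {R : realType} {d : nat} {dT : measure_display}
    {T : measurableType dT} (W : set 'rV[R]_d) Pi (w : T -> 'rV[R]_d) :
  convex_set (W : set (convex_lmodType 'rV[R]_d)) -> is_euclid_proj W Pi ->
  measurable_vec w -> measurable_vec (fun x => Pi (w x)).
Proof.
move=> Wc WP mw j.
exact: (measurable_vec_continuous (continuous_proj_coord Wc WP (j := j))).
Qed.

(** * Independence *)

Section independence.
Context {R : realType} {dO : measure_display} {O : measurableType dO}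
  (P : probability O R).

Definition indep_events (A B : set O) := P (A `&` B) = (P A * P B)%E.

Definition indep_rv (Y V : O -> R) := forall A B, measurable A -> measurable B ->
  indep_events (Y @^-1` A) (V @^-1` B).

Lemma indep_eventsC A B : indep_events A B -> indep_events B A.
Proof. by rewrite /indep_events setIC muleC. Qed.

(** The finite measures [A |-> P (A & B)] and [A |-> P B * P A] agree on the pi-system [G], hence on
    the sigma-algebra it generates. *)
Lemma indep_events_sigma (G : set (set O)) (B : set O) :
  setI_closed G -> G setT -> G `<=` measurable -> measurable B ->
  (forall A, G A -> indep_events A B) ->
  forall A, <<s G >> A -> indep_events A B.
Proof.
move=> GI GT Gm mB h A sA.
have PB0 : 0 <= fine (P B) by exact: fine_ge0.
have PBE : (fine (P B))%:E = P B by rewrite fineK// fin_num_measure.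
have : mrestr P mB A = mscale (NngNum PB0) P A.
  apply: (@g_sigma_algebra_measure_unique _ R O G Gm (fun=> setT)) => //.
  - by rewrite bigcup_const.
  - by move=> C GC; rewrite [LHS](h _ GC) muleC -[X in (X * _)%E]PBE.
  - move=> k; apply: (@le_lt_trans _ _ (P B)); last first.
      by apply: le_lt_trans (probability_le1 _ mB) _; rewrite ltry.
    by rewrite -[X in (_ <= P X)%E]setTI.
by rewrite /mrestr/= /mscale/= PBE /indep_events muleC.
Qed.

(** Independence identifies the joint law with the product of the marginals; Tonelli then gives
    integrability of the product and Fubini its mean. *)
Lemma expectation_indep (Y V : O -> R) :
  measurable_fun setT Y -> measurable_fun setT V -> indep_rv Y V ->
  P.-integrable setT (EFin \o Y) -> P.-integrable setT (EFin \o V) ->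
  P.-integrable setT (EFin \o (fun x => Y x * V x)) /\
  \int[P]_x (Y x * V x) = \int[P]_x Y x * \int[P]_x V x.
Proof.
move=> mY mV YV iY iV.
pose Y' : {mfun O >-> R} := mfun_Sub (mem_set mY).
pose V' : {mfun O >-> R} := mfun_Sub (mem_set mV).
have mYV : measurable_fun setT (fun x => (Y x, V x)) by exact: measurable_fun_pair.
pose J : {mfun O >-> (R * R)%type} := mfun_Sub (mem_set mYV).
pose pY := distribution P Y'; pose pV := distribution P V'.
pose pJ := distribution P J.
have pJE X : measurable X -> (pY \x pV)%E X = pJ X.
  by apply: product_measure_unique => A B mA mB; exact: YV.
have EJ f : (\int[pJ]_z f z = \int[(pY \x pV)%E]_z f z)%E.
  by apply: eq_measure_integral => A mA _; apply/esym; exact: pJE.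
have mM : measurable_fun setT (fun z : R * R => (z.1 * z.2)%:E).
  by apply/measurable_EFinP; apply: measurable_funM.
have iYd : pY.-integrable setT (EFin : R -> \bar R).
  apply/integrableP; split; first exact: EFin_measurable.
  rewrite ge0_integral_distribution//; last first.
    exact: (@measurableT_comp _ _ _ _ _ _ (@abse R)).
  by case/integrableP : iY.
have iVd : pV.-integrable setT (EFin : R -> \bar R).
  apply/integrableP; split; first exact: EFin_measurable.
  rewrite ge0_integral_distribution//; last first.
    exact: (@measurableT_comp _ _ _ _ _ _ (@abse R)).
  by case/integrableP : iV.
have iYV : (pY \x pV)%E.-integrable setT (fun z : R * R => (z.1 * z.2)%:E).
  apply/integrable12ltyP => //=.
  under eq_integral => x _.
    under eq_integral do rewrite normrM EFinM.
    rewrite ge0_integralZl//; last exact: measurableT_comp.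
    over.
  rewrite ge0_integralZr//=; last 2 first.
    exact: measurableT_comp.
    exact: integral_ge0.
  case/integrableP : iYd => _ iYd; case/integrableP : iVd => _ iVd.
  by rewrite lte_mul_pinfty// ?integral_ge0// ge0_fin_numE ?integral_ge0.
have iYVP : P.-integrable setT (EFin \o (fun x => Y x * V x)).
  apply/integrableP; split; first by apply/measurable_EFinP; apply: measurable_funM.
  rewrite (_ : (\int[P]_x _)%E = (\int[pJ]_z `|(z.1 * z.2)%:E|)%E); last first.
    by rewrite ge0_integral_distribution//; exact: measurableT_comp.
  rewrite EJ.
  by case/integrableP : iYV.
split=> //; rewrite /Rintegral.
have -> : (\int[P]_x (Y x * V x)%:E = (\int[P]_x (Y x)%:E) * (\int[P]_x (V x)%:E))%E.
  transitivity (\int[pJ]_z (z.1 * z.2)%:E)%E.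
    by rewrite integral_distribution.
  rewrite EJ.
  rewrite -integral12_prod_meas1//=.
  have fV : (\int[pV]_y y%:E)%E \is a fin_num by exact: integrable_fin_num.
  transitivity (\int[pY]_x (x%:E * \int[pV]_y y%:E))%E.
    apply: eq_integral => x _; rewrite /fubini_F/=.
    by under eq_integral do rewrite EFinM; rewrite integralZl.
  rewrite /= -(fineK fV) integralZr//= fineK//.
  by rewrite !integral_distribution.
by rewrite fineM//; exact: integrable_fin_num.
Qed.

End independence.

(** * Variables built from disjoint blocks of an independent family *)

Section cylinders.
Context {R : realType} {dO : measure_display} {O : measurableType dO}
  (P : probability O R) {J : finType} (X : J -> O -> R).
Hypothesis Xind : mutually_independent P X.
Implicit Types S : {set J}.

Definition disjoint_sets S S' := forall j, j \in S -> j \notin S'.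

Definition cylinders S : set (set O) :=
  [set A | exists B : J -> set R, [/\ forall j, measurable (B j),
     forall j, j \notin S -> B j = setT & A = \bigcap_j (X j @^-1` B j)]].

(** A copy of [O] with the sigma-algebra generated by the [X j] for [j] in [S]. Measurability on
    this type expresses dependence on those coordinates alone, and all general measurability lemmas
    apply to it unchanged. *)
Definition coord_space S := g_sigma_algebraType (cylinders S).

Lemma cylindersT S : cylinders S setT.
Proof.
by exists (fun=> setT); split => //; apply/seteqP; split.
Qed.

Lemma cylindersI S : setI_closed (cylinders S).
Proof.
move=> _ _ [B [mB BT ->]] [C [mC CT ->]].
exists (fun j => B j `&` C j); split.
- by move=> j; exact: measurableI.
- by move=> j jS; rewrite BT// CT// setTI.
- by rewrite -bigcapI; apply: eq_bigcapr => j _; rewrite preimage_setI.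
Qed.

Lemma cylinders_measurable S : cylinders S `<=` measurable.
Proof.
move=> _ [B [mB _ ->]]; apply: fin_bigcap_measurable => // j _.
by rewrite -[X in measurable X]setTI; exact: Xind.1.
Qed.

Lemma coord_measurable S A : <<s cylinders S >> A -> measurable A.
Proof.
apply: smallest_sub; last exact: cylinders_measurable.
exact: sigma_algebra_measurable.
Qed.

Lemma cylinders_sub S S' : S \subset S' -> cylinders S `<=` cylinders S'.
Proof.
move=> /fintype.subsetP SS _ [B [mB BT ->]]; exists B; split => // j jS'.
by apply: BT; apply: contra jS'; exact: SS.
Qed.

(** At every index at least one of the two constraints is [setT], so the product formula for the
    intersection splits factor by factor. *)
Lemma indep_cylinders S S' A B : disjoint_sets S S' ->
  cylinders S A -> cylinders S' B -> indep_events P A B.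
Proof.
move=> SS' [C [mC CT ->]] [C' [mC' CT' ->]]; rewrite /indep_events.
rewrite -bigcapI.
have -> : \bigcap_j (X j @^-1` C j `&` X j @^-1` C' j) =
    \bigcap_j (X j @^-1` (C j `&` C' j)).
  by apply: eq_bigcapr => j _; rewrite preimage_setI.
rewrite !Xind.2//; last by move=> j; exact: measurableI.
rewrite -big_split; apply: eq_bigr => j _ /=.
have [jS|/CT ->] := boolP (j \in S); last first.
  by rewrite setTI preimage_setT probability_setT mul1e.
by rewrite (CT' j (SS' _ jS)) setIT preimage_setT probability_setT mule1.
Qed.

(** The pi-system extension is applied twice, once to each of the two events. *)
Lemma indep_coord_events S S' A B : disjoint_sets S S' ->
  <<s cylinders S >> A -> <<s cylinders S' >> B -> indep_events P A B.
Proof.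
move=> SS' sA sB.
apply: indep_events_sigma sA => //.
- exact: cylindersI.
- exact: cylindersT.
- exact: cylinders_measurable.
- exact: coord_measurable sB.
- move=> C cC; apply: indep_eventsC.
  apply: indep_events_sigma sB => //.
  + exact: cylindersI.
  + exact: cylindersT.
  + exact: cylinders_measurable.
  + exact: cylinders_measurable cC.
  + by move=> D cD; apply: indep_eventsC; exact: indep_cylinders cC cD.
Qed.

Lemma coord_measurable_fun S (V : O -> R) :
  measurable_fun setT (V : coord_space S -> R) -> measurable_fun setT V.
Proof.
move=> mV _ B mB; apply: (@coord_measurable S).
exact: mV measurableT _ mB.
Qed.

Lemma coord_measurable_fun_sub S S' (V : O -> R) : S \subset S' ->
  measurable_fun setT (V : coord_space S -> R) ->
  measurable_fun setT (V : coord_space S' -> R).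
Proof.
move=> SS' mV _ B mB; have := mV measurableT B mB.
apply: sub_sigma_algebra2.
exact: cylinders_sub.
Qed.

Lemma measurable_coord S j : j \in S ->
  measurable_fun setT (X j : coord_space S -> R).
Proof.
move=> jS _ B mB; apply: sub_sigma_algebra.
exists (fun i => if i == j then B else setT); split.
- by move=> i; case: ifP.
- by move=> i iS; case: eqP => // ij; rewrite ij jS in iS.
- rewrite setTI; apply/seteqP; split => x /=.
    by move=> Bx i _ /=; case: eqP => // ->.
  by move=> /(_ j I) /=; rewrite eqxx.
Qed.

Lemma indep_coord_rv S S' (Y V : O -> R) : disjoint_sets S S' ->
  measurable_fun setT (Y : coord_space S -> R) ->
  measurable_fun setT (V : coord_space S' -> R) -> indep_rv P Y V.
Proof.
move=> SS' mY mV A B mA mB; apply: (indep_coord_events SS').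
- by have := mY measurableT A mA; rewrite setTI.
- by have := mV measurableT B mB; rewrite setTI.
Qed.

End cylinders.

(** * Moments of the normal distribution *)

Lemma Rintegral_prob_cst {R : realType} {d : measure_display}
    {T : measurableType d} (P : probability T R) (c : R) : \int[P]__ c = c.
Proof.
rewrite Rintegral_cst//; transitivity (c * fine 1%E); last by rewrite mulr1.
by congr (c * fine _); exact: probability_setT.
Qed.

Section gaussian.
Context {R : realType}.
Implicit Types (m s x : R).

Local Notation mu := (@lebesgue_measure R).

(** Change of variables with the Radon-Nikodym derivative, which is almost everywhere [normal_pdf]
    since both have the same integral over every measurable set. *)
Lemma ge0_integral_normal_prob m s (f : R -> \bar R) :
  (forall x, 0 <= f x)%E -> measurable_fun setT f ->
  (\int[normal_prob m s]_x f x = \int[mu]_x (f x * (normal_pdf m s x)%:E))%E.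
Proof.
move=> f0 mf.
have dom := normal_prob_dominates m s.
rewrite -(Radon_Nikodym_SigmaFinite.change_of_variables dom)//.
apply: ae_eq_integral => //.
- apply: emeasurable_funM => //; apply: (measurable_int mu).
  exact: Radon_Nikodym_SigmaFinite.f_integrable.
- apply: emeasurable_funM => //; apply/measurable_EFinP.
  exact: measurable_normal_pdf.
- apply: ae_eqe_mul2l => /=.
  apply: integral_ae_eq => //=.
  + exact: Radon_Nikodym_SigmaFinite.f_integrable.
  + by apply/measurable_EFinP; exact: measurable_normal_pdf.
  + move=> E _ mE.
    by rewrite -Radon_Nikodym_SigmaFinite.f_integral.
Qed.

Variables (s : R).
Hypothesis s0 : s != 0.
Local Notation nu := (normal_prob (0 : R) s).

Let measurable_expR_comp (f : R -> R) : measurable_fun setT f ->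
  measurable_fun setT (fun x => (expR (f x))%:E).
Proof. by move=> mf; apply/measurable_EFinP; exact: measurableT_comp. Qed.

(* The integrand is the density of N(h, s^2) relative to N(0, s^2); bounding
   it below by its first-order expansion gives the mean. *)
Let integral_expR_lin h :
  (\int[nu]_x (expR ((h * x - h ^+ 2 / 2) / s ^+ 2))%:E = 1)%E.
Proof.
rewrite ge0_integral_normal_prob//; last first.
  apply: measurable_expR_comp; apply: measurable_funM => //.
  by apply: measurable_funB => //; exact: measurable_funM.
rewrite -(integral_normal_pdf h s); apply: eq_integral => x _.
rewrite -EFinM !normal_pdfE// /normal_fun mulrCA -expRD; congr (_ * expR _)%:E.
by field; rewrite s0.
Qed.

(* Up to the factor r, the integrand is the density of N(0, (s/r)^2) relative to
   N(0, s^2); letting r tend to 1 bounds the second moment. *)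
Let integral_expR_sqr r : 0 < r ->
  (\int[nu]_x (expR (x ^+ 2 * ((1 - r ^+ 2) / (2 * s ^+ 2))))%:E = (r^-1)%:E)%E.
Proof.
move=> r0.
have sr0 : s / r != 0 by rewrite mulf_neq0// invr_neq0// gt_eqF.
rewrite ge0_integral_normal_prob//; last first.
  by apply: measurable_expR_comp; apply: measurable_funM.
transitivity (\int[mu]_x ((r^-1)%:E * (normal_pdf 0 (s / r) x)%:E))%E.
  apply: eq_integral => x _; rewrite -!EFinM !normal_pdfE// /normal_fun.
  rewrite [in LHS]mulrCA -expRD [in RHS]mulrA; congr (_ * expR _)%:E.
    rewrite /normal_peak (_ : (s / r) ^+ 2 * pi *+ 2 = r^-1 ^+ 2 * (s ^+ 2 * pi *+ 2)).
      rewrite sqrtrM ?sqr_ge0// sqrtr_sqr gtr0_norm ?invr_gt0// invfM invrK.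
      by rewrite mulrA mulVf ?mul1r// gt_eqF.
    by field; rewrite gt_eqF.
  by field; rewrite s0 gt_eqF.
rewrite ge0_integralZl//.
- by rewrite integral_normal_pdf mule1.
- by apply/measurable_EFinP; exact: measurable_normal_pdf.
- by move=> x _; rewrite lee_fin normal_pdf_ge0.
- by rewrite lee_fin invr_ge0 ltW.
Qed.

Let mx2 : measurable_fun setT (fun x : R => (x ^+ 2)%:E).
Proof. by apply/measurable_EFinP; exact: exprn_measurable. Qed.

(** Apply [1 + y <= exp y] with [y = c x^2], [c = (1 - r^2) / (2 s^2)]: then [1 + c E x^2 <= 1/r].
    The factor [1 - r] cancels, so the bound tends to [s^2] as [r] tends to 1. *)
Let x2_bound r : 0 < r < 1 ->
  (\int[nu]_x (x ^+ 2)%:E <= (2 * s ^+ 2 / (r * (1 + r)))%:E)%E.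
Proof.
move=> /andP[r0 r1].
have c0 : 0 < (1 - r ^+ 2) / (2 * s ^+ 2).
  have r21 : r ^+ 2 < 1 by rewrite expr_lt1// ltW.
  by apply: divr_gt0; rewrite ?subr_gt0// mulr_gt0// exprn_even_gt0.
have : (1 + ((1 - r ^+ 2) / (2 * s ^+ 2))%:E * \int[nu]_x (x ^+ 2)%:E <= (r^-1)%:E)%E.
  rewrite -(integral_expR_sqr r0) -ge0_integralZl//; last 2 first.
    by move=> x _; rewrite lee_fin sqr_ge0.
    by rewrite lee_fin ltW.
  have -> : 1%E = (\int[nu]_x 1)%E.
    by rewrite integral_cst//= mul1e; apply/esym; exact: probability_setT.
  rewrite -ge0_integralD//; last 2 first.
    by move=> x _; rewrite -EFinM lee_fin mulr_ge0 ?sqr_ge0// ltW.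
    exact: measurable_funeM.
  apply: ge0_le_integral => //.
  - by move=> x _; rewrite -EFinM -EFinD lee_fin addr_ge0// mulr_ge0 ?sqr_ge0// ltW.
  - by apply: emeasurable_funD => //; exact: measurable_funeM.
  - by apply: measurable_expR_comp; exact: measurable_funM.
  - by move=> x _; rewrite -EFinM -EFinD lee_fin mulrC expR_ge1Dx.
set M := (\int[nu]_x _)%E.
case: M => [M| |].
- rewrite -EFinM -EFinD !lee_fin => h.
  have {h} h : M * ((1 - r ^+ 2) / (2 * s ^+ 2)) <= (1 - r) / r.
    have -> : (1 - r) / r = r^-1 - 1 by field; rewrite gt_eqF.
    lra.
  move: h; rewrite -ler_pdivlMr// => /le_trans; apply.
  rewrite le_eqVlt; apply/orP; left; apply/eqP.
  have h1 : 1 - r != 0 by rewrite subr_eq0 gt_eqF.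
  have h2 : 1 + r != 0 by rewrite gt_eqF// addr_gt0.
  have h3 : 1 - r ^+ 2 != 0 by rewrite -[1](expr1n R 2) subr_sqr mulf_neq0.
  by field; rewrite ?s0 ?h1 ?h2 ?h3 ?gt_eqF.
- by rewrite gt0_muley ?lte_fin// addey.
- by rewrite leNye.
Qed.

Let x2_integral : (\int[nu]_x (x ^+ 2)%:E <= (s ^+ 2)%:E)%E.
Proof.
apply/lee_addgt0Pr => e e0.
have s20 : 0 < s ^+ 2 by rewrite exprn_even_gt0.
(* With [q = e / (4 (e + s^2))], [r >= 1 - q] gives [r (1 + r) >= 2 - 3q], and
   [(s^2 + e)(2 - 3q) = 2 s^2 + 5e/4]. The floor 1/2 makes [r] visibly positive. *)
pose r := Num.max (1/2) (1 - e / (4 * (e + s ^+ 2))).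
have a0 : 0 < e / (4 * (e + s ^+ 2)) by rewrite divr_gt0// mulr_gt0// addr_gt0.
have r01 : 0 < r < 1.
  by rewrite lt_max; apply/andP; split; [lra|rewrite gt_max; lra].
apply: le_trans (x2_bound r01) _; rewrite -EFinD lee_fin.
have r2 : 1 - e / (4 * (e + s ^+ 2)) <= r by rewrite le_max lexx orbT.
have h4 : e / (4 * (e + s ^+ 2)) * (4 * (e + s ^+ 2)) = e.
  by rewrite divfK// gt_eqF// mulr_gt0// addr_gt0.
move: r01 => /andP[r0 r1].
rewrite ler_pdivrMr ?mulr_gt0 ?addr_gt0//.
set q := e / _ in a0 r2 h4.
have hq : (1 - q) * (2 - q) <= r * (1 + r).
  have : q <= 1/4.
    rewrite ler_pdivrMr ?mulr_gt0 ?addr_gt0//; nra.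
  move=> q4; apply: ler_pM; lra.
apply: (@le_trans _ _ ((s ^+ 2 + e) * ((1 - q) * (2 - q)))); last first.
  by rewrite ler_wpM2l// addr_ge0// ltW.
nra.
Qed.

Variables (dO : measure_display) (O : measurableType dO) (P : probability O R)
  (X : O -> R).
Hypotheses (mX : measurable_fun setT X)
  (lawX : forall A, measurable A -> P (X @^-1` A) = normal_prob 0 s A).

Let ge0_law (f : R -> \bar R) : measurable_fun setT f -> (forall x, 0 <= f x)%E ->
  (\int[P]_x f (X x) = \int[nu]_x f x)%E.
Proof.
move=> mf f0; pose X' : {mfun O >-> R} := mfun_Sub (mem_set mX).
(* The normal law lives on [measurableTypeR R] whereas [X] takes values in [R]; the identity map
   transports it. *)
have mid : @measurable_fun _ _ (measurableTypeR R) R setT idfun.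
  by move=> _ B mB; rewrite setTI.
pose idT : {mfun measurableTypeR R >-> R} := 
  @mfun_Sub _ _ (measurableTypeR R) R idfun (mem_set mid).
pose nuP : probability (measurableTypeR R) R := normal_prob 0 s.
transitivity (\int[distribution nuP idT]_y f y)%E.
  rewrite -(ge0_integral_distribution X')//.
  by apply: eq_measure_integral => A mA _; exact: lawX.
by rewrite ge0_integral_distribution.
Qed.

Lemma normal_sqr_integrable : P.-integrable setT (EFin \o (fun w => X w ^+ 2)).
Proof.
apply/integrableP; split.
  by apply/measurable_EFinP; exact: measurable_funX.
under eq_integral do rewrite /= ger0_norm ?sqr_ge0//.
rewrite (ge0_law mx2) => [|x]; last by rewrite lee_fin sqr_ge0.
by apply: le_lt_trans x2_integral _; rewrite ltry.
Qed.

Lemma normal_sqr_le : \int[P]_w (X w ^+ 2) <= s ^+ 2.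
Proof.
rewrite -lee_fin fineK; last by apply: integrable_fin_num => //; exact: normal_sqr_integrable.
rewrite /= (ge0_law mx2) => [|x]; last by rewrite lee_fin sqr_ge0.
exact: x2_integral.
Qed.

Lemma normal_integrable : P.-integrable setT (EFin \o X).
Proof.
have i2 : P.-integrable setT (EFin \o (fun w => 1 + X w ^+ 2)).
  rewrite (_ : _ \o _ = (cst 1 \+ (EFin \o (fun w => X w ^+ 2)%R))%E); last first.
    by apply/funext => w; rewrite /= EFinD.
  apply: integrableD => //; last exact: normal_sqr_integrable.
  exact: finite_measure_integrable_cst.
apply: le_integrable i2 => //.
- exact/measurable_EFinP.
- move=> w _; rewrite lee_fin [leRHS]ger0_norm ?addr_ge0 ?sqr_ge0//.
  rewrite -(real_normK (num_real (X w))).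
  have := sqr_ge0 (`|X w| - 1); have := normr_ge0 (X w); nra.
Qed.

(** Shifting the density by the unknown mean [m] itself, the first-order bound reads
    [1 + m^2 / (2 s^2) <= 1], which forces [m = 0]. *)
Lemma normal_mean : \int[P]_w X w = 0.
Proof.
set m := Rintegral _ _ _.
have iX := normal_integrable.
pose a := m / s ^+ 2; pose b := 1 - m ^+ 2 / 2 / s ^+ 2.
have i1 : P.-integrable setT (EFin \o (fun w => a * X w)).
  rewrite (_ : _ \o _ = (fun w => a%:E * (EFin \o X) w)%E); last first.
    by apply/funext => w; rewrite /= EFinM.
  exact: integrableZl.
have i3 : P.-integrable setT (EFin \o (fun w : O => b)).
  exact: finite_measure_integrable_cst.
have i2 : P.-integrable setT (EFin \o (fun w => a * X w + b)).
  rewrite (_ : _ \o _ = ((EFin \o (fun w => a * X w)%R) \+ (EFin \o (fun w => b)%R))%E); last first.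
    by apply/funext => w; rewrite /= EFinD.
  exact: integrableD.
have mf : measurable_fun setT (fun x : R => (expR ((m * x - m ^+ 2 / 2) / s ^+ 2))%:E).
  apply: measurable_expR_comp; apply: measurable_funM => //.
  by apply: measurable_funB => //; exact: measurable_funM.
have il : (\int[P]_w (expR ((m * X w - m ^+ 2 / 2) / s ^+ 2))%:E = 1)%E.
  rewrite (ge0_law mf) => [|x]; last by rewrite lee_fin expR_ge0.
  exact: integral_expR_lin.
have ie : P.-integrable setT (EFin \o (fun w => expR ((m * X w - m ^+ 2 / 2) / s ^+ 2))).
  apply/integrableP; split.
    exact: (measurableT_comp mf mX).
  by under eq_integral do rewrite /= ger0_norm ?expR_ge0//; rewrite il ltry.
have : \int[P]_w (a * X w + b) <= 1.
  have <- : \int[P]_w (expR ((m * X w - m ^+ 2 / 2) / s ^+ 2)) = 1.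
    by rewrite /Rintegral il.
  apply: le_Rintegral => // w _; apply: le_trans (expR_ge1Dx _).
  rewrite le_eqVlt; apply/orP; left; apply/eqP; rewrite /a /b; ring.
rewrite RintegralD// RintegralZl// Rintegral_prob_cst -/m.
have -> : a * m + b = 1 + (m ^+ 2 / 2) / s ^+ 2 by rewrite /a /b; field; rewrite s0.
rewrite gerDl pmulr_lle0 ?invr_gt0 ?exprn_even_gt0// => h.
by apply/eqP; rewrite -sqrf_eq0 eq_le sqr_ge0 andbT; lra.
Qed.

End gaussian.

(** * Expectations and the good event *)

Section null_modification.
Context {R : realType} {d : measure_display} {T : measurableType d}
  (mu : {measure set T -> \bar R}).
Local Open Scope ereal_scope.
Import HBNNSimple.

(** The integral is a supremum over simple functions below [f]. Restricting such a function to the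
    complement of [N] keeps its integral and places it below [g]. *)
Let ge0_le_integral_off_null (N : set T) (f g : T -> \bar R) :
  measurable N -> mu N = 0 -> (forall x, 0 <= f x) -> (forall x, 0 <= g x) ->
  (forall x, ~ N x -> f x = g x) -> \int[mu]_x f x <= \int[mu]_x g x.
Proof.
move=> mN N0 f0 g0 fg; rewrite ge0_integralTE//.
apply: ge_ereal_sup => _ [h /= hf <-].
have mNC : measurable (~` N) by exact: measurableC.
rewrite ge0_integralTE//; apply: le_ereal_sup_tmp.
exists (sintegral mu (proj_nnsfun h mNC)); last first.
  have -> : sintegral mu h = \int[mu]_x (h x)%:E.
    by rewrite integral_nnsfun// patch_setT.
  have -> : sintegral mu (proj_nnsfun h mNC) = \int[mu]_x (proj_nnsfun h mNC x)%:E.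
    by rewrite integral_nnsfun// patch_setT.
  rewrite (@ge0_ae_eq_integral _ _ _ mu setT _ (fun x => (proj_nnsfun h mNC x)%:E))//.
  - exact/measurable_EFinP.
  - exact/measurable_EFinP.
  - by move=> x _; rewrite lee_fin.
  - by move=> x _; rewrite lee_fin.
  - exists N; split => // x /= nh; apply: contrapT => Nx; apply: nh => _.
    by rewrite /= mindicE mem_set ?mulr1.
exists (proj_nnsfun h mNC) => //= x.
rewrite mindicE; have [xN|xN] := boolP (x \in ~` N); last by rewrite mulr0.
rewrite mulr1; apply: le_trans (hf x) _; rewrite fg//; exact: set_mem xN.
Qed.

Lemma integral_eq_off_null (N : set T) (f g : T -> \bar R) :
  measurable N -> mu N = 0 -> (forall x, ~ N x -> f x = g x) ->
  \int[mu]_x f x = \int[mu]_x g x.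
Proof.
move=> mN N0 fg; rewrite [LHS]integralE [RHS]integralE.
by congr (_ - _); apply/eqP; rewrite eq_le; apply/andP; split;
  apply: (ge0_le_integral_off_null mN N0) => // x Nx;
  rewrite ?funeposE ?funenegE fg.
Qed.

End null_modification.

Section integrable_real.
Context {R : realType} {d : measure_display} {T : measurableType d}
  (P : probability T R).
Implicit Types f g : T -> R.

Definition integrable_rv f := P.-integrable setT (EFin \o f).

Lemma integrable_rvZ (a : R) f : integrable_rv f ->
  integrable_rv (fun x => a * f x).
Proof.
move=> fi; rewrite /integrable_rv (_ : _ \o _ = (fun x => a%:E * (EFin \o f) x)%E).
  exact: integrableZl.
by apply/funext => x; rewrite /= EFinM.
Qed.

Lemma integrable_rvD f g : integrable_rv f -> integrable_rv g ->
  integrable_rv (fun x => f x + g x).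
Proof.
move=> fi gi.
rewrite /integrable_rv (_ : _ \o _ = ((EFin \o f) \+ (EFin \o g))%E).
  exact: integrableD.
by apply/funext => x; rewrite /= EFinD.
Qed.

Lemma integrable_rv_cst (a : R) : integrable_rv (fun=> a).
Proof. exact: finite_measure_integrable_cst. Qed.

Lemma integrable_rvB f g : integrable_rv f -> integrable_rv g ->
  integrable_rv (fun x => f x - g x).
Proof.
move=> fi gi; rewrite (_ : (fun x => _) = (fun x => f x + (-1) * g x)).
  by apply: integrable_rvD => //; exact: integrable_rvZ.
by apply/funext => x; rewrite mulN1r.
Qed.

Lemma integrable_rv_sum (I : Type) (s : seq I) (F : I -> T -> R) :
  (forall i, integrable_rv (F i)) ->
  integrable_rv (fun x => \sum_(i <- s) F i x).
Proof.
move=> Fi; elim: s => [|i s ih].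
  by under eq_fun do rewrite big_nil; exact: integrable_rv_cst.
by under eq_fun do rewrite big_cons; exact: integrable_rvD.
Qed.

Lemma integrable_rv_bounded (M : R) f : measurable_fun setT f ->
  (forall x, `|f x| <= M) -> integrable_rv f.
Proof.
move=> mf fM; have iM : integrable_rv (fun=> M) := integrable_rv_cst M.
apply: le_integrable iM => //; first exact/measurable_EFinP.
by move=> x _; rewrite lee_fin (le_trans (fM x))// ler_norm.
Qed.

Lemma Rintegral_sumr (I : Type) (s : seq I) (F : I -> T -> R) :
  (forall i, integrable_rv (F i)) ->
  \int[P]_x (\sum_(i <- s) F i x) = \sum_(i <- s) \int[P]_x F i x.
Proof.
move=> Fi; elim: s => [|i s ih].
  by under eq_Rintegral do rewrite big_nil; rewrite Rintegral_prob_cst big_nil.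
under eq_Rintegral do rewrite big_cons.
rewrite RintegralD ?big_cons ?ih//; first exact: Fi.
exact: (@integrable_rv_sum _ s F).
Qed.

Lemma Rintegral_prob_indic (A : set T) (c : R) : measurable A ->
  P A = c%:E -> \int[P]_x \1_A x = c.
Proof.
move=> mA PA; rewrite /Rintegral integral_indic// setIT.
exact: (congr1 fine PA).
Qed.

Lemma le_Rintegral_rv f g : integrable_rv f -> integrable_rv g ->
  (forall x, f x <= g x) -> \int[P]_x f x <= \int[P]_x g x.
Proof. by move=> fi gi fg; apply: le_Rintegral. Qed.

End integrable_real.

(** * The high-probability event for the dataset *)

Section good_event.
Context {R : realType} {n : nat} {dZ : measure_display} {Zt : measurableType dZ}
  {D : probability Zt R} {dO : measure_display} {O : measurableType dO}
  {P : probability O R} {Z : 'I_n -> O -> Zt} {Gf : Zt -> R} {G k gamma : R}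
  {S : set Zt}.
Hypotheses (n0 : (0 < n)%N) (Zind : mutually_independent P Z)
  (Zlaw : forall i A, measurable A -> P (Z i @^-1` A) = D A)
  (Gf0 : forall z, 0 <= Gf z) (mGf : measurable_fun setT Gf)
  (mS : measurable S) (DS : D S = 1%E) (k1 : 1 < k) (G0 : 0 < G)
  (gamma0 : 0 < gamma)
  (momG : (((\int[D]_z ((Gf z) `^ k)%:E) `^ k^-1) <= G%:E)%E).

Let kpos : 0 < k. Proof. exact: lt_trans k1. Qed.

Let mGk : measurable_fun setT (fun z => ((Gf z) `^ k)%:E).
Proof.
apply/measurable_EFinP.
by apply: (@measurableT_comp _ _ _ _ _ _ (@powR R ^~ k)) => //; exact: measurable_powR.
Qed.

Let moment : (\int[D]_z ((Gf z) `^ k)%:E <= (G `^ k)%:E)%E.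
Proof.
have I0 : (0 <= \int[D]_z ((Gf z) `^ k)%:E)%E.
  by apply: integral_ge0 => z _; rewrite lee_fin powR_ge0.
move: momG I0; case: (\int[D]_z _)%E => [r| |] //=.
  rewrite !lee_fin => rG r0.
  have -> : r = (r `^ k^-1) `^ k by rewrite -powRrM mulVf ?powRr1// gt_eqF.
  by apply: ge0_ler_powR; rewrite ?nnegrE ?powR_ge0// ltW.
(* An infinite moment would have an infinite k-th root, against [momG]. *)
by rewrite gt_eqF ?invr_gt0.
Qed.

Let mZ i : measurable_fun setT (Z i). Proof. exact: Zind.1. Qed.

Let mean o := n%:R^-1 * \sum_(i < n) Gf (Z i o) `^ k.

Let mmean : measurable_fun setT mean.
Proof.
apply: measurable_funM => //; apply: measurable_sum => i.
have /measurable_EFinP mG := mGk.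
exact: (measurableT_comp mG (mZ i)).
Qed.

Let integral_mean : (\int[P]_o (mean o)%:E <= (G `^ k)%:E)%E.
Proof.
have -> : (\int[P]_o (mean o)%:E =
    n%:R^-1%:E * \sum_(i < n) \int[P]_o (Gf (Z i o) `^ k)%:E)%E.
  rewrite -ge0_integral_sum//; last 2 first.
  - by move=> i; exact: (measurableT_comp mGk (mZ i)).
  - by move=> i o _; rewrite lee_fin powR_ge0.
  rewrite -ge0_integralZl//.
  - by apply: eq_integral => o _; rewrite sumEFin -EFinM.
  - by apply: emeasurable_sum => i; exact: (measurableT_comp mGk (mZ i)).
  - by move=> o _; apply: sume_ge0 => i _; rewrite lee_fin powR_ge0.
have Zi i : (\int[P]_o (Gf (Z i o) `^ k)%:E = \int[D]_z ((Gf z) `^ k)%:E)%E.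
  pose Z' : {mfun O >-> Zt} := mfun_Sub (mem_set (mZ i)).
  rewrite -(@ge0_integral_distribution _ _ _ _ _ _ Z' (fun z => ((Gf z) `^ k)%:E))//.
    by apply: eq_measure_integral => A mA _; exact: Zlaw.
  by move=> z; rewrite lee_fin powR_ge0.
under eq_bigr do rewrite Zi.
have fin : (\int[D]_z ((Gf z) `^ k)%:E)%E \is a fin_num.
  rewrite ge0_fin_numE; first by apply: le_lt_trans moment _; rewrite ltry.
  by apply: integral_ge0 => z _; rewrite lee_fin powR_ge0.
rewrite -(fineK fin) sumEFin -EFinM sumr_const card_ord -[X in _ * X]mulr_natl.
by rewrite mulrA mulVf ?mul1r ?fineK// pnatr_eq0 -lt0n.
Qed.

(* The support condition holds almost surely and Markov's inequality bounds
   the probability that the empirical k-th moment exceeds G^k / gamma. *)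
Lemma good_event : exists E, [/\ measurable E, ((1 - gamma)%:E <= P E)%E &
  forall o, E o -> (forall i, S (Z i o)) /\
    n%:R^-1 * \sum_(i < n) Gf (Z i o) `^ k <= G `^ k / gamma].
Proof.
pose A := \bigcap_i (Z i @^-1` S); pose B := [set o | mean o <= G `^ k / gamma].
have mA : measurable A.
  by apply: fin_bigcap_measurable => // i _; rewrite -[X in measurable X]setTI; exact: mZ.
have PA : P A = 1%E.
  by rewrite /A (Zind.2 (fun=> S))// big1// => i _; rewrite Zlaw.
have mB : measurable B.
  rewrite (_ : B = mean @^-1` `]-oo, G `^ k / gamma]%classic); last first.
    by apply/seteqP; split => o /=; rewrite in_itv.
  by rewrite -[X in measurable X]setTI; exact: mmean.
exists (A `&` B); split; first exact: measurableI.
- have c0 : 0 < G `^ k / gamma by rewrite divr_gt0// powR_gt0.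
  have mean0 o : 0 <= mean o.
    by rewrite mulr_ge0// sumr_ge0// => i _; rewrite powR_ge0.
  have PBC : (P (~` B) <= gamma%:E)%E.
    have : ((G `^ k / gamma)%:E * P (~` B) <= (G `^ k)%:E)%E.
      apply: le_trans integral_mean.
      rewrite -[X in (X <= _)%E](_ : \int[P]_(o in ~` B) (G `^ k / gamma)%:E = _)%E; last first.
        by rewrite integral_cst//; exact: measurableC.
      apply: (@le_trans _ _ (\int[P]_(o in ~` B) (mean o)%:E)%E).
        apply: ge0_le_integral => //.
        + exact: measurableC.
        + by move=> o _; rewrite lee_fin ltW.
        + by apply/measurable_EFinP; apply: measurable_funTS.
        + by move=> o /= /negP; rewrite -ltNge lee_fin; exact: ltW.
      apply: ge0_subset_integral => //; first exact: measurableC.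
      exact/measurable_EFinP.
      by move=> o _; rewrite lee_fin.
    have fP : P (~` B) \is a fin_num by apply: fin_num_measure; exact: measurableC.
    rewrite -(fineK fP) -EFinM !lee_fin mulrAC ler_pdivrMr// ler_pM2l//.
    exact: powR_gt0.
  have PAC : P (~` A) = 0%E by rewrite probability_setC// PA subee.
  have PAB : (P (~` (A `&` B)) <= gamma%:E)%E.
    rewrite setCI; apply: le_trans (measureU2 _ _ _) _; try exact: measurableC.
    apply: (@le_trans _ _ (0 + gamma%:E)%E); last by rewrite add0e.
    have PAC0 : (P (~` A) <= 0)%E by rewrite PAC.
    by apply: leeD; [exact: PAC0|exact: PBC].
  have fAB : P (A `&` B) \is a fin_num by apply: fin_num_measure; exact: measurableI.
  move: PAB; rewrite probability_setC; last exact: measurableI.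
  rewrite -(fineK fAB) -EFinB !lee_fin; lra.
- by move=> o [Ao Bo]; split => [i|]; [exact: Ao|exact: Bo].
Qed.

End good_event.

(** * DP-SGD on a fixed dataset *)

Section dpsgd.
Context {R : realType} {d n T : nat} {dO : measure_display}
  {O : measurableType dO} {P : probability O R} {X : nat -> 'I_n -> O -> R}
  {N : nat -> 'I_d -> O -> R} {U : O -> R}.
Variables (F : 'I_n -> 'rV[R]_d -> R) (W : set 'rV[R]_d)
  (Pi : 'rV[R]_d -> 'rV[R]_d) (w0 u : 'rV[R]_d) (eta b tau s : R).
Hypotheses (n0 : (0 < n)%N) (dF : forall i w, differentiable (F i) w)
  (Wconv : convex_set (W : set (convex_lmodType 'rV[R]_d)))
  (Wbnd : bounded_euclid W) (PiW : is_euclid_proj W Pi) (Ww0 : W w0) (Wu : W u)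
  (eta0 : 0 <= eta) (b1 : 1 <= b) (tau0 : 0 < tau) (s0 : s != 0).
Local Notation fam := (@alg_family R dO O T n d X N U).
Hypothesis famind : mutually_independent P fam.
Hypothesis Xlaw1 : forall t i, (t < T)%N -> P (X t i @^-1` [set 1]) = (b / n%:R)%:E.
Hypothesis Nlaw : forall t j A, (t < T)%N -> measurable A ->
  P (N t j @^-1` A) = normal_prob 0 s A.

Definition iterate (t : nat) (o : O) : 'rV[R]_d :=
  dpsgd_iter (fun i => grad (F i)) Pi w0 (fun=> eta) b tau
    (fun t i => X t i o == 1) (fun t => \row_j N t j o) t.

Definition clipped_grad t i o := clip (grad (F i) (iterate t o)) tau.

Definition included t i o : R := (X t i o == 1)%:R.

(** The batch sum is written over all indices with 0-1 weights, so that it is linear in the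
    inclusion indicators. *)
Definition noisy_grad t o : 'rV[R]_d :=
  b^-1 *: (\sum_i included t i o *: clipped_grad t i o) + \row_j N t j o.

Lemma iterateS t o : iterate t.+1 o = Pi (iterate t o - eta *: noisy_grad t o).
Proof.
have e : \sum_(i < n | X t i o == 1) clip (grad (F i) (iterate t o)) tau =
    \sum_i included t i o *: clipped_grad t i o.
  rewrite big_mkcond; apply: eq_bigr => i _; rewrite /included.
  by case: ifP; rewrite ?scale1r ?scale0r.
by rewrite /noisy_grad -e.
Qed.

Lemma iterate_in t o : W (iterate t o).
Proof. by case: t => [//|t]; rewrite iterateS; exact: (PiW _).1. Qed.

Definition past (t : nat) : {set alg_index T n d} :=
  finset (fun j : alg_index T n d => match j with
    | inl (inl (r, _)) => (r < t)%N
    | inl (inr (r, _)) => (r < t)%N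
    | inr _ => false end).

Definition sampling (t : nat) : {set alg_index T n d} :=
  finset (fun j : alg_index T n d => match j with
    | inl (inl (r, _)) => r == t :> nat
    | inl (inr _) => false
    | inr _ => false end).

(** Contains the batch of step [t] but not its noise: the noise must be independent of the batch as
    well as of the iterate for its cross term with the clipped sum to vanish. *)
Definition sampled_past (t : nat) : {set alg_index T n d} :=
  finset (fun j : alg_index T n d => (j \in past t) || (j \in sampling t)).

Lemma sub_past t r : (t <= r)%N -> past t \subset past r.
Proof.
move=> tr; apply/fintype.subsetP => -[[[x i]|[x i]]|x]; rewrite !inE //;
  by move=> /leq_trans; apply.
Qed.

Lemma sub_sampled_past t : past t \subset sampled_past t.
Proof. by apply/fintype.subsetP => j; rewrite [in X in _ -> X]inE => ->. Qed.

Lemma measurable_included (S : {set alg_index T n d}) t (tT : (t < T)%N) i :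
  inl (inl (Ordinal tT, i)) \in S ->
  measurable_fun setT (included t i : coord_space fam S -> R).
Proof.
move=> jS; rewrite (_ : included t i = (\1_[set (1 : R)] : R -> R) \o X t i).
  apply: measurableT_comp; first exact: measurable_indic.
  exact: (measurable_coord (X := fam) jS).
apply/funext => o; rewrite /included /= indicE; congr ((nat_of_bool _)%:R).
by apply/idP/idP => [/eqP ->|]; rewrite inE => // /eqP.
Qed.

(** Adaptedness: [iterate t] is built from the draws of steps before [t]. The bound [t <= T] is
    there because the family indexes only steps below [T]. *)
Lemma measurable_iterate t : (t <= T)%N ->
  measurable_vec (iterate t : coord_space fam (past t) -> 'rV[R]_d).
Proof.
elim: t => [_|t ih tT]; first exact: measurable_vec_cst.
have mw : measurable_vec (iterate t : coord_space fam (past t.+1) -> 'rV[R]_d).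
  move=> j; apply: (coord_measurable_fun_sub (sub_past (leqnSn t))).
  exact: ih (ltnW tT) j.
have -> : iterate t.+1 = fun o => Pi (iterate t o - eta *: noisy_grad t o).
  by apply/funext => o; exact: iterateS.
apply: (measurable_vec_proj Wconv PiW).
have -> : (fun o => iterate t o - eta *: noisy_grad t o) =
    (fun o => iterate t o + (- eta) *: noisy_grad t o).
  by apply/funext => o; rewrite scaleNr.
apply: measurable_vecD => //; apply: measurable_vecZ => //.
apply: measurable_vecD.
  apply: measurable_vecZ => //; apply: measurable_vec_sum => i _.
  apply: measurable_vecZ; last by apply: measurable_clip; exact: measurable_grad.
  by apply: (measurable_included (tT := tT)); rewrite inE.
move=> j; under eq_fun do rewrite mxE.
have jS : inl (inr (Ordinal tT, j)) \in past t.+1 by rewrite inE.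
exact: (measurable_coord (X := fam) jS).
Qed.

Lemma measurable_iterate_rv t : (t <= T)%N -> measurable_vec (iterate t).
Proof.
by move=> tT j; apply: (coord_measurable_fun famind); exact: measurable_iterate.
Qed.

Lemma enorm_iterate_le t o : enorm (iterate t o - u) <= diam W.
Proof. exact: le_diam (iterate_in t o) Wu. Qed.

(** * Conditional moments and the one-step inequality *)

Section step.
Variables (t : nat) (tT : (t < T)%N).
Let v o := iterate t o - u.
Let p := b / n%:R.
Let K := 2 * tau ^+ 2 + d%:R * s ^+ 2.

Let diam0 : 0 <= diam W.
Proof. by apply: le_trans (enorm_iterate_le 0 point); exact: enorm_ge0. Qed.

Let n_gt0 : 0 < n%:R :> R. Proof. by rewrite ltr0n. Qed.

Let b_gt0 : 0 < b. Proof. exact: lt_le_trans b1. Qed.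

Let p01 : 0 < p <= 1.
Proof.
rewrite divr_gt0//= -lee_fin -(Xlaw1 (Ordinal n0) tT).
apply: probability_le1; rewrite -[X in measurable X]setTI.
exact: (famind.1 (inl (inl (Ordinal tT, Ordinal n0)))).
Qed.

Let mv : measurable_vec (v : coord_space fam (past t) -> 'rV[R]_d).
Proof.
apply: measurable_vecD; last exact: measurable_vec_cst.
exact: measurable_iterate (ltnW tT).
Qed.

Let mc i : measurable_vec (clipped_grad t i : coord_space fam (past t) -> 'rV[R]_d).
Proof.
apply: measurable_clip; apply: measurable_grad => //.
exact: measurable_iterate (ltnW tT).
Qed.

Let cle i o : enorm (clipped_grad t i o) <= tau.
Proof. by apply: enorm_clip; exact: ltW. Qed.

Let rv (S : {set alg_index T n d}) (V : O -> R) :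
  measurable_fun setT (V : coord_space fam S -> R) -> measurable_fun setT V.
Proof. exact: (coord_measurable_fun famind). Qed.

Let included_le1 i o : `|included t i o| <= 1.
Proof. by rewrite /included; case: eqP; rewrite ?normr1 ?normr0. Qed.

Let sampling_i i : inl (inl (Ordinal tT, i)) \in sampling t.
Proof. by rewrite inE /=. Qed.

Let integrable_included i : integrable_rv P (included t i).
Proof.
apply: (@integrable_rv_bounded _ _ _ _ 1) => //.
exact: rv (measurable_included (sampling_i i)).
Qed.

Let E_included i : \int[P]_o included t i o = p.
Proof.
have -> : included t i = \1_(X t i @^-1` [set 1]).
  apply/funext => o; rewrite indicE; congr ((nat_of_bool _)%:R).
  by apply/idP/idP => [/eqP h|]; rewrite inE => // /eqP.
apply: Rintegral_prob_indic; last exact: Xlaw1.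
rewrite -[X in measurable X]setTI.
exact: (famind.1 (inl (inl (Ordinal tT, i)))).
Qed.

Let E_included2 i l : \int[P]_o (included t i o * included t l o) =
  if i == l then p else p ^+ 2.
Proof.
case: eqP => [->|/eqP il].
  rewrite -(E_included l); apply: eq_Rintegral => o _.
  by rewrite /included; case: eqP; rewrite ?mulr1 ?mulr0.
have mi := measurable_included (sampling_i i); have ml := measurable_included (sampling_i l).
have il_indep : indep_rv P (included t i) (included t l).
  apply: (@indep_coord_rv _ _ _ _ _ _ famind
    (finset (pred1 (inl (inl (Ordinal tT, i)) : alg_index T n d)))
    (finset (pred1 (inl (inl (Ordinal tT, l)) : alg_index T n d)))).
  + by move=> j; rewrite !inE /= => /eqP ->; apply: contra il => /eqP[] ->.
  + by apply: (measurable_included (tT := tT)); rewrite inE /= eqxx.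
  + by apply: (measurable_included (tT := tT)); rewrite inE /= eqxx.
have [_ ->] := expectation_indep (rv mi) (rv ml) il_indep
  (integrable_included i) (integrable_included l).
by rewrite !E_included expr2.
Qed.

Let E_sampling_past (Y V : O -> R) :
  measurable_fun setT (Y : coord_space fam (sampling t) -> R) ->
  measurable_fun setT (V : coord_space fam (past t) -> R) ->
  integrable_rv P Y -> integrable_rv P V ->
  integrable_rv P (fun o => Y o * V o) /\
  \int[P]_o (Y o * V o) = \int[P]_o Y o * \int[P]_o V o.
Proof.
move=> mY mV iY iV; apply: expectation_indep => //; [exact: rv mY|exact: rv mV|].
apply: (indep_coord_rv famind _ mY mV) => -[[[r i]|[r i]]|r]; rewrite !inE //.
by move=> /eqP ->; rewrite ltnn.
Qed.

Let E_noise (V : O -> R) j :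
  measurable_fun setT (V : coord_space fam (sampled_past t) -> R) ->
  integrable_rv P V ->
  integrable_rv P (fun o => N t j o * V o) /\ \int[P]_o (N t j o * V o) = 0.
Proof.
move=> mV iV.
have jS : inl (inr (Ordinal tT, j)) \in
    (finset (pred1 (inl (inr (Ordinal tT, j)) : alg_index T n d))).
  by rewrite inE /= eqxx.
have mN := measurable_coord (X := fam) jS.
have mN' : measurable_fun setT (N t j) := rv mN.
have iN := normal_integrable s0 mN' (fun A => @Nlaw t j A tT).
have N0 := normal_mean s0 mN' (fun A => @Nlaw t j A tT).
have [i1 ->] : integrable_rv P (fun o => N t j o * V o) /\
  \int[P]_o (N t j o * V o) = \int[P]_o N t j o * \int[P]_o V o.
  apply: expectation_indep => //; first exact: rv mV.
  apply: (indep_coord_rv famind _ mN mV) => h; rewrite !inE => /eqP -> /=.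
  by rewrite ltnn.
by rewrite N0 mul0r.
Qed.

Let integrable_dot (a c : O -> 'rV[R]_d) (A B : R) :
  measurable_vec (a : coord_space fam (past t) -> 'rV[R]_d) ->
  measurable_vec (c : coord_space fam (past t) -> 'rV[R]_d) ->
  (forall o, enorm (a o) <= A) -> (forall o, enorm (c o) <= B) ->
  integrable_rv P (fun o => dotp (a o) (c o)).
Proof.
move=> ma mc' aA cB; apply: (@integrable_rv_bounded _ _ _ _ (A * B)).
  exact: rv (measurable_dotp ma mc').
move=> o; apply: (@le_trans _ _ (enorm (a o) * enorm (c o))); last first.
  by apply: ler_pM; rewrite ?enorm_ge0.
rewrite ler_norml dotp_le andbT lerNl -dotpNl.
by apply: le_trans (dotp_le _ _) _; rewrite enormN.
Qed.

Let idcv i := integrable_dot (mc i) mv (cle i) (enorm_iterate_le t).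
Let idcc i l := integrable_dot (mc i) (mc l) (cle i) (cle l).

Let dotp_noise o w : dotp (\row_j N t j o) w = \sum_j N t j o * w ord0 j.
Proof. by apply: eq_bigr => j _; rewrite mxE. Qed.

Let noisy_dot o : dotp (noisy_grad t o) (v o) =
  b^-1 * (\sum_i included t i o * dotp (clipped_grad t i o) (v o)) +
  \sum_j N t j o * v o ord0 j.
Proof.
rewrite /noisy_grad dotpDl dotpZl dotp_suml dotp_noise; congr (_ * _ + _).
by apply: eq_bigr => i _; rewrite dotpZl.
Qed.

Let noisy_sqr o : dotp (noisy_grad t o) (noisy_grad t o) =
  b^-1 ^+ 2 * (\sum_i \sum_l included t i o * included t l o *
     dotp (clipped_grad t i o) (clipped_grad t l o)) +
  2 * b^-1 * (\sum_i \sum_j N t j o * (included t i o * clipped_grad t i o ord0 j)) +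
  \sum_j N t j o ^+ 2.
Proof.
rewrite /noisy_grad; set A := \sum_i included t i o *: clipped_grad t i o; set z := \row_j _.
rewrite dotpDl !dotpDr !dotpZl !dotpZr (dotpC A z).
have -> : dotp A A = \sum_i \sum_l included t i o * included t l o *
     dotp (clipped_grad t i o) (clipped_grad t l o).
  rewrite {1}/A dotp_suml; apply: eq_bigr => i _.
  rewrite dotpC /A dotp_suml; apply: eq_bigr => l _.
  move: (clipped_grad t i o) (clipped_grad t l o) => c c'.
  by rewrite dotpZl dotpZr (dotpC c') mulrA (mulrC (included t l o)).
have -> : dotp z A =
    \sum_i \sum_j N t j o * (included t i o * clipped_grad t i o ord0 j).
  rewrite dotpC /A dotp_suml; apply: eq_bigr => i _.
  rewrite dotpC dotp_noise; apply: eq_bigr => j _.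
  by rewrite mxE.
have -> : dotp z z = \sum_j N t j o ^+ 2.
  by rewrite dotp_noise; apply: eq_bigr => j _; rewrite mxE expr2.
ring.
Qed.

Let included_past i (V : O -> R) :
  measurable_fun setT (V : coord_space fam (past t) -> R) ->
  integrable_rv P V -> integrable_rv P (fun o => included t i o * V o) /\
  \int[P]_o (included t i o * V o) = p * \int[P]_o V o.
Proof.
move=> mV iV; rewrite -(E_included i).
exact: (E_sampling_past (measurable_included (sampling_i i)) mV).
Qed.

Let mv_sampled j : measurable_fun setT
  ((fun o => v o ord0 j) : coord_space fam (sampled_past t) -> R).
Proof. exact: (coord_measurable_fun_sub (@sub_sampled_past t) (mv j)). Qed.

Let iv j : integrable_rv P (fun o => v o ord0 j).
Proof.
apply: (@integrable_rv_bounded _ _ _ _ (diam W)); first exact: rv (mv j).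
by move=> o; apply: le_trans (coord_le_enorm _ _) (enorm_iterate_le t o).
Qed.

(** Each sample enters with weight [p / b = 1 / n], so subsampling is unbiased for the mean clipped
    gradient. *)
Let E_noisy_dot :
  integrable_rv P (fun o => dotp (noisy_grad t o) (v o)) /\
  \int[P]_o dotp (noisy_grad t o) (v o) =
  n%:R^-1 * \sum_i \int[P]_o dotp (clipped_grad t i o) (v o).
Proof.
under eq_fun do rewrite noisy_dot.
have i1 i := included_past i (measurable_dotp (mc i) mv) (idcv i).
have i2 j := E_noise j (mv_sampled j) (iv j).
have i1' := integrable_rvZ b^-1
  (integrable_rv_sum (index_enum 'I_n) (fun i => (i1 i).1)).
have i2' := integrable_rv_sum (index_enum 'I_d) (fun j => (i2 j).1).
split; first exact: integrable_rvD.
rewrite RintegralD// RintegralZl//; last first.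
  exact: (integrable_rv_sum (index_enum 'I_n) (fun i => (i1 i).1)).
rewrite (Rintegral_sumr _ (fun i => (i1 i).1)) (Rintegral_sumr _ (fun j => (i2 j).1)).
rewrite [X in _ + X]big1 ?addr0; last by move=> j _; exact: (i2 j).2.
under eq_bigr do rewrite (i1 _).2.
rewrite -mulr_sumr mulrA /p; congr (_ * _); field.
by rewrite !gt_eqF.
Qed.

Let minc i j : measurable_fun setT
  ((fun o => included t i o * clipped_grad t i o ord0 j)
    : coord_space fam (sampled_past t) -> R).
Proof.
apply: measurable_funM.
  by apply: (measurable_included (tT := tT)); rewrite inE sampling_i orbT.
exact: (coord_measurable_fun_sub (@sub_sampled_past t) (mc i j)).
Qed.

Let iinc i j : integrable_rv P
  (fun o => included t i o * clipped_grad t i o ord0 j).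
Proof.
apply: (@integrable_rv_bounded _ _ _ _ (1 * tau)); first exact: rv (minc i j).
move=> o; rewrite normrM; apply: ler_pM => //.
exact: le_trans (coord_le_enorm _ _) (cle i o).
Qed.

(** Diagonal pairs carry weight [p], the others [p^2], and every inner product has mean at most
    [tau^2]. *)
Let E_noisy_sqr :
  integrable_rv P (fun o => dotp (noisy_grad t o) (noisy_grad t o)) /\
  \int[P]_o dotp (noisy_grad t o) (noisy_grad t o) <= K.
Proof.
under eq_fun do rewrite noisy_sqr.
have i1 i l : integrable_rv P (fun o => included t i o * included t l o *
     dotp (clipped_grad t i o) (clipped_grad t l o)) /\
   \int[P]_o (included t i o * included t l o *
     dotp (clipped_grad t i o) (clipped_grad t l o)) =
   (if i == l then p else p ^+ 2) *
     \int[P]_o dotp (clipped_grad t i o) (clipped_grad t l o).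
  have mI : measurable_fun setT ((fun o => included t i o * included t l o)
      : coord_space fam (sampling t) -> R).
    by apply: measurable_funM; exact: (measurable_included (sampling_i _)).
  rewrite -E_included2; apply: (E_sampling_past mI) => //.
    exact: measurable_dotp.
  apply: (@integrable_rv_bounded _ _ _ _ (1 * 1)); first exact: rv mI.
  by move=> o; rewrite normrM ler_pM.
have i2 i j := E_noise j (minc i j) (iinc i j).
have mN j : measurable_fun setT (N t j) := famind.1 (inl (inr (Ordinal tT, j))).
have i3 j := normal_sqr_integrable s0 (mN j) (fun A => @Nlaw t j A tT).
have i1s i := integrable_rv_sum (index_enum 'I_n) (fun l => (i1 i l).1).
have i2s i := integrable_rv_sum (index_enum 'I_d) (fun j => (i2 i j).1).
have i1ss := integrable_rv_sum (index_enum 'I_n) i1s.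
have i2ss := integrable_rv_sum (index_enum 'I_n) i2s.
have i1Z := integrable_rvZ (b^-1 ^+ 2) i1ss.
have i2Z := integrable_rvZ (2 * b^-1) i2ss.
have i3s := integrable_rv_sum (index_enum 'I_d) i3.
have i12 := integrable_rvD i1Z i2Z.
split; first exact: integrable_rvD.
rewrite RintegralD// RintegralD// RintegralZl// RintegralZl//.
rewrite (Rintegral_sumr _ i1s) (Rintegral_sumr _ i2s) (Rintegral_sumr _ i3).
rewrite [X in _ + 2 * _ * X + _]big1; last first.
  move=> i _; rewrite (Rintegral_sumr _ (fun j => (i2 i j).1)) big1// => j _.
  exact: (i2 i j).2.
rewrite mulr0 addr0 /K; apply: lerD; last first.
  rewrite mulr_natl -[X in _ *+ X](card_ord d) -sumr_const; apply: ler_sum => j _.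
  exact: (normal_sqr_le s0 (mN j) (fun A => @Nlaw t j A tT)).
have E_le i l : \int[P]_o dotp (clipped_grad t i o) (clipped_grad t l o) <= tau ^+ 2.
  rewrite -[leRHS](@Rintegral_prob_cst R _ O P); apply: le_Rintegral_rv => //.
    exact: integrable_rv_cst.
  move=> o; apply: le_trans (dotp_le _ _) _.
  by rewrite expr2; apply: ler_pM; rewrite ?enorm_ge0.
have /andP[p0 p1] := p01.
(* Counting [n] instead of [n - 1] off-diagonal entries makes the total, once divided by [b^2],
   exactly [(1/b + 1) tau^2]. *)
have row_le i : \sum_l \int[P]_o (included t i o * included t l o *
     dotp (clipped_grad t i o) (clipped_grad t l o)) <=
     p * tau ^+ 2 + n%:R * (p ^+ 2 * tau ^+ 2).
  rewrite (bigD1 i)//=; apply: lerD.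
    by rewrite (i1 i i).2 eqxx ler_wpM2l// ltW.
  apply: (@le_trans _ _ (\sum_(l < n | l != i) (p ^+ 2 * tau ^+ 2))).
    apply: ler_sum => l li; rewrite (i1 i l).2 eq_sym (negbTE li) ler_wpM2l//.
    exact: sqr_ge0.
  rewrite [leRHS]mulr_natl -[X in _ *+ X](card_ord n) -sumr_const.
  rewrite [leRHS](bigID (fun l => l != i))/= lerDl sumr_ge0// => l _.
  by rewrite mulr_ge0// sqr_ge0.
have sum_le : \sum_i \int[P]_o (\sum_l included t i o * included t l o *
     dotp (clipped_grad t i o) (clipped_grad t l o)) <=
     n%:R * (p * tau ^+ 2 + n%:R * (p ^+ 2 * tau ^+ 2)).
  rewrite [leRHS]mulr_natl -[X in _ *+ X](card_ord n) -sumr_const.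
  apply: ler_sum => i _; rewrite (Rintegral_sumr _ (fun l => (i1 i l).1)).
  exact: row_le.
apply: le_trans (ler_wpM2l _ sum_le) _; first by rewrite sqr_ge0.
have -> : b^-1 ^+ 2 * (n%:R * (p * tau ^+ 2 + n%:R * (p ^+ 2 * tau ^+ 2))) =
    (b^-1 + 1) * tau ^+ 2.
  by rewrite /p; field; rewrite !gt_eqF.
by rewrite ler_wpM2r ?sqr_ge0// -[2]/(1 + 1) lerD2r invf_le1.
Qed.

Lemma dpsgd_step : \int[P]_o enorm (iterate t.+1 o - u) ^+ 2 <=
  \int[P]_o enorm (iterate t o - u) ^+ 2 -
  2 * eta * (n%:R^-1 * \sum_i \int[P]_o dotp (clipped_grad t i o) (iterate t o - u)) +
  eta ^+ 2 * (2 * tau ^+ 2 + d%:R * s ^+ 2).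
Proof.
have idist r : (r <= T)%N -> integrable_rv P (fun o => enorm (iterate r o - u) ^+ 2).
  move=> rT; apply: (@integrable_rv_bounded _ _ _ _ (diam W ^+ 2)).
    apply: measurable_funX; apply: measurable_enorm; apply: measurable_vecD.
      exact: measurable_iterate_rv.
    exact: measurable_vec_cst.
  move=> o; rewrite ger0_norm ?sqr_ge0// lerXn2r ?nnegrE ?enorm_ge0//.
  exact: enorm_iterate_le.
have [ig Eg] := E_noisy_sqr; have [ih Eh] := E_noisy_dot.
have it := idist t (ltnW tT).
have i1 := integrable_rvB it (integrable_rvZ (2 * eta) ih).
have i2 := integrable_rvD i1 (integrable_rvZ (eta ^+ 2) ig).
apply: (@le_trans _ _ (\int[P]_o (enorm (iterate t o - u) ^+ 2 -
    2 * eta * dotp (noisy_grad t o) (v o) +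
    eta ^+ 2 * dotp (noisy_grad t o) (noisy_grad t o)))).
  apply: le_Rintegral_rv => //; first exact: idist.
  move=> o; rewrite iterateS; apply: le_trans (proj_closer Wconv PiW _ Wu) _.
  rewrite addrAC (enormB_sqr (iterate t o - u)) (enorm_sqr (eta *: _)).
  rewrite !dotpZr dotpZl (dotpC (iterate t o - u)).
  by rewrite le_eqVlt; apply/orP; left; apply/eqP; rewrite /v; ring.
rewrite RintegralD//; last exact: (integrable_rvZ (eta ^+ 2) ig).
rewrite RintegralB//; last exact: (integrable_rvZ (2 * eta) ih).
rewrite !RintegralZl// Eh lerD2l.
by rewrite ler_wpM2l// sqr_ge0.
Qed.

End step.

Lemma dpsgd_telescope m : (m <= T)%N ->
  2 * eta * (\sum_(t < m) n%:R^-1 * \sum_i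
    \int[P]_o dotp (clipped_grad t i o) (iterate t o - u)) <=
  diam W ^+ 2 - \int[P]_o enorm (iterate m o - u) ^+ 2 +
  m%:R * (eta ^+ 2 * (2 * tau ^+ 2 + d%:R * s ^+ 2)).
Proof.
elim: m => [_|m ih mT].
  rewrite big_ord0 mulr0 mul0r addr0 subr_ge0.
  have -> : \int[P]_o enorm (iterate 0 o - u) ^+ 2 = enorm (w0 - u) ^+ 2.
    transitivity (\int[P]__ (enorm (w0 - u) ^+ 2)); first by [].
    exact: Rintegral_prob_cst.
  by rewrite lerXn2r ?nnegrE ?enorm_ge0 ?(le_trans (enorm_ge0 _) (le_diam Wbnd Ww0 Wu)) ?le_diam.
rewrite big_ord_recr/= mulrDr -natr1 mulrDl mul1r.
have := ih (ltnW mT); have := dpsgd_step mT; lra.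
Qed.

(** * From the telescoped sum to the risk of the random output *)

Section risk.
Variables (Gz : 'I_n -> R) (k M : R).
Let f w := n%:R^-1 * \sum_(i < n) F i w.
Hypotheses (fconv : convex_function (W : set (convex_lmodType 'rV[R]_d)) f)
  (umin : forall w, W w -> f u <= f w) (k1 : 1 < k)
  (GzF : forall i w, W w -> enorm (grad (F i) w) <= Gz i)
  (GzM : n%:R^-1 * \sum_(i < n) Gz i `^ k <= M).
Hypothesis Ulaw : forall r, (r < T)%N -> P (U @^-1` [set r%:R]) = (T%:R^-1)%:E.
Hypothesis T0 : (0 < T)%N.

Let bias := M / tau `^ (k - 1).
Let gap t o := f (iterate t o) - f u.

Let diam0 : 0 <= diam W.
Proof. by apply: le_trans (enorm_iterate_le 0 point); exact: enorm_ge0. Qed.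

Let clip_bias : n%:R^-1 * \sum_(i < n) Gz i `^ k / tau `^ (k - 1) <= bias.
Proof.
rewrite -mulr_suml mulrA /bias ler_wpM2r// invr_ge0; exact: powR_ge0.
Qed.

Let gap_le t o : gap t o <=
  n%:R^-1 * (\sum_i dotp (clipped_grad t i o) (iterate t o - u)) + bias * diam W.
Proof.
have df : differentiable f (iterate t o).
  rewrite (_ : f = n%:R^-1 *: \sum_i F i); last first.
    by apply/funext => w; rewrite /f /= fct_sumE.
  by apply: differentiableZ; exact: differentiable_sum.
apply: le_trans (convex_first_order fconv df Wu (iterate_in t o)) _.
rewrite grad_mean// dotpZl dotp_suml.
apply: (@le_trans _ _ (n%:R^-1 * (\sum_i dotp (clipped_grad t i o) (iterate t o - u)) +
   n%:R^-1 * \sum_(i < n) Gz i `^ k / tau `^ (k - 1) * diam W)).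
  rewrite -mulrDr ler_wpM2l// -big_split; apply: ler_sum => i _ /=.
  rewrite -lerBlDl -dotpBl; apply: le_trans (dotp_le _ _) _.
  apply: ler_pM; rewrite ?enorm_ge0//; last exact: enorm_iterate_le.
  by apply: enorm_sub_clip => //; apply: GzF; exact: iterate_in.
rewrite lerD2l -mulr_suml mulrA; apply: ler_wpM2r => //.
Qed.

Let gap_ge0 t o : 0 <= gap t o.
Proof. by rewrite subr_ge0; apply: umin; exact: iterate_in. Qed.

(** A crude bound, for integrability of the gap and for the case of zero diameter. *)
Let gap_bounded t o : gap t o <= (tau + bias) * diam W.
Proof.
apply: le_trans (gap_le t o) _; rewrite mulrDl lerD2r.
rewrite ler_pdivrMl ?ltr0n// mulr_natl -[X in _ *+ X](card_ord n) -sumr_const.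
apply: ler_sum => i _; apply: le_trans (dotp_le _ _) _.
apply: ler_pM; rewrite ?enorm_ge0//; last exact: enorm_iterate_le.
by apply: enorm_clip; exact: ltW.
Qed.

Let measurable_gap (S : {set alg_index T n d}) t : past t \subset S -> (t <= T)%N ->
  measurable_fun setT (gap t : coord_space fam S -> R).
Proof.
move=> tS tT; apply: measurable_funB => //.
apply: measurable_funM => //; apply: measurable_sum => i.
apply: (measurable_vec_continuous (g := F i)).
  by move=> w; exact: differentiable_continuous.
by move=> j; apply: (coord_measurable_fun_sub tS); exact: measurable_iterate.
Qed.

Let integrable_gap t : (t <= T)%N -> integrable_rv P (gap t).
Proof.
move=> tT; apply: (@integrable_rv_bounded _ _ _ _ ((tau + bias) * diam W)).
  apply: (coord_measurable_fun famind); exact: (measurable_gap (subxx _) tT).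
by move=> o; rewrite ger0_norm.
Qed.

Let average_gap := T%:R^-1 * \sum_(t < T) \int[P]_o gap t o.

(** With zero diameter the prescribed step size is also zero and the bound dividing by [eta] says
    nothing; here the crude bound is already 0. *)
Lemma average_gap_diam0 : diam W = 0 -> average_gap <= 0.
Proof.
move=> D0; rewrite pmulr_rle0 ?invr_gt0 ?ltr0n//; apply: sumr_le0 => t _.
rewrite -[leRHS](@Rintegral_prob_cst R _ O P); apply: le_Rintegral_rv.
- by apply: integrable_gap; exact: ltnW.
- exact: integrable_rv_cst.
- by move=> o; apply: le_trans (gap_bounded _ _) _; rewrite D0 mulr0.
Qed.

Lemma average_gap_le : 0 < eta -> average_gap <=
  diam W ^+ 2 / (2 * T%:R * eta) + eta / 2 * (2 * tau ^+ 2 + d%:R * s ^+ 2) +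
  bias * diam W.
Proof.
move=> eta_gt0.
have T_gt0 : 0 < T%:R :> R by rewrite ltr0n.
have idot t i : (t < T)%N ->
    integrable_rv P (fun o => dotp (clipped_grad t i o) (iterate t o - u)).
  move=> tT; apply: (@integrable_rv_bounded _ _ _ _ (tau * diam W)).
    apply: measurable_dotp.
      apply: measurable_clip; apply: measurable_grad => //.
      exact: measurable_iterate_rv (ltnW tT).
    apply: measurable_vecD; last exact: measurable_vec_cst.
    exact: measurable_iterate_rv (ltnW tT).
  move=> o; apply: (@le_trans _ _ (enorm (clipped_grad t i o) * enorm (iterate t o - u))).
    rewrite ler_norml dotp_le andbT lerNl -dotpNl.
    by apply: le_trans (dotp_le _ _) _; rewrite enormN.
  apply: ler_pM; rewrite ?enorm_ge0//; last exact: enorm_iterate_le.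
  by apply: enorm_clip; exact: ltW.
have gap_t (t : 'I_T) : \int[P]_o gap t o <= n%:R^-1 * (\sum_i
    \int[P]_o dotp (clipped_grad t i o) (iterate t o - u)) + bias * diam W.
  have tT := ltn_ord t.
  have is_ := integrable_rv_sum (index_enum 'I_n) (fun i => idot t i tT).
  have iZ := integrable_rvZ n%:R^-1 is_.
  have ic := integrable_rv_cst P (bias * diam W).
  apply: (le_trans (le_Rintegral_rv (integrable_gap (ltnW tT)) (integrable_rvD iZ ic)
    (gap_le t))).
  rewrite RintegralD// RintegralZl// Rintegral_prob_cst.
  by rewrite (Rintegral_sumr _ (fun i => idot t i tT)).
have := dpsgd_telescope (leqnn T).
set C := \sum_(t < T) _ => tele.
have : \sum_(t < T) \int[P]_o gap t o <= C + T%:R * (bias * diam W).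
  apply: (le_trans (ler_sum _ (fun t _ => gap_t t))).
  by rewrite big_split/= sumr_const card_ord mulr_natl.
have last0 : 0 <= \int[P]_o enorm (iterate T o - u) ^+ 2.
  by apply: Rintegral_ge0 => o _; exact: sqr_ge0.
move=> sum_le; rewrite /average_gap mulrC ler_pdivrMr//; apply: le_trans sum_le _.
rewrite mulrDl (mulrC T%:R) lerD2r.
set Q := 2 * tau ^+ 2 + _ in tele *.
have -> : (diam W ^+ 2 / (2 * T%:R * eta) + eta / 2 * Q) * T%:R =
   (diam W ^+ 2 + T%:R * (eta ^+ 2 * Q)) / (2 * eta).
  by field; rewrite !gt_eqF.
by rewrite ler_pdivlMr ?mulr_gt0// mulrC; lra.
Qed.

Let drawn r o : R := (U o == r%:R)%:R.

Let mU : measurable_fun setT U := famind.1 (inr tt).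

Let mU1 (r : R) : measurable (U @^-1` [set r]).
Proof. by rewrite -[X in measurable X]setTI; exact: mU. Qed.

Let drawnE r : drawn r = \1_(U @^-1` [set r%:R]).
Proof.
apply/funext => o; rewrite /drawn indicE; congr ((nat_of_bool _)%:R).
by apply/idP/idP => [/eqP h|]; rewrite inE => // /eqP.
Qed.

Let E_drawn_gap (r : 'I_T) : integrable_rv P (fun o => drawn r o * gap r o) /\
  \int[P]_o (drawn r o * gap r o) = T%:R^-1 * \int[P]_o gap r o.
Proof.
have rT := ltn_ord r.
have US : (inr tt : alg_index T n d) \in finset (pred1 (inr tt : alg_index T n d)).
  by rewrite inE /= eqxx.
have mdrawn : measurable_fun setT
    (drawn r : coord_space fam (finset (pred1 (inr tt : alg_index T n d))) -> R).
  rewrite (_ : drawn r = (\1_[set (r%:R : R)] : R -> R) \o U); last first.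
    by rewrite drawnE; apply/funext => o; rewrite /= !indicE.
  apply: measurableT_comp; first exact: measurable_indic.
  exact: (measurable_coord (X := fam) US).
have idrawn : integrable_rv P (drawn r).
  apply: (@integrable_rv_bounded _ _ _ _ 1); first exact: (coord_measurable_fun famind mdrawn).
  by move=> o; rewrite /drawn; case: eqP; rewrite ?normr1 ?normr0.
have Edrawn : \int[P]_o drawn r o = T%:R^-1.
  by rewrite drawnE; apply: Rintegral_prob_indic => //; exact: Ulaw.
have mgap := measurable_gap (subxx _) (ltnW rT).
rewrite -Edrawn; apply: expectation_indep => //.
- exact: (coord_measurable_fun famind mdrawn).
- exact: (coord_measurable_fun famind mgap).
- apply: (indep_coord_rv famind _ mdrawn mgap) => j; rewrite !inE /= => /eqP ->.
  by [].
- exact: integrable_gap (ltnW rT).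
Qed.

(* On the event that U misses {0, ..., T-1} the output may be an iterate
   beyond T, about which nothing is known; this event is negligible. *)
Lemma expected_output : (\int[P]_o (f (dpsgd_output (fun i => grad (F i)) Pi w0
    (fun=> eta) b tau X N U o))%:E = (f u + average_gap)%:E)%E.
Proof.
pose hit := \big[setU/set0]_(r < T) (U @^-1` [set r%:R]).
have mhit : measurable hit by apply: bigsetU_measurable => r _.
have Phit : P hit = 1%E.
  rewrite /hit (measure_bigsetU P (F := fun r => U @^-1` [set (r%:R : R)]))//.
    transitivity (\sum_(r < T) (T%:R^-1)%:E : \bar R)%E.
      by apply: eq_bigr => r _; exact: Ulaw.
    rewrite sumEFin sumr_const card_ord -[X in X%:E]mulr_natl divff//.
    by rewrite pnatr_eq0 -lt0n.
  move=> i j _ _ [w [] /= Ui Uj]; apply/eqP; rewrite -(eqr_nat R); apply/eqP.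
  by rewrite -Ui Uj.
have P0 : P (~` hit) = 0%E by rewrite probability_setC// Phit subee.
(* On [hit] exactly one indicator [drawn r o] equals 1, so [h] is there the value of [f] at the
   output; unlike that value, it is integrable by construction. *)
pose h o := f u + \sum_(r < T) drawn r o * gap r o.
rewrite (@integral_eq_off_null _ _ _ P (~` hit) _ (fun o => (h o)%:E))//; last 2 first.
- exact: measurableC.
- move=> o /contrapT; rewrite /hit -(bigcup_mkord T (fun r => U @^-1` [set (r%:R : R)])) => -[r /= rT Uo].
  rewrite /dpsgd_output Uo natrK; congr (_%:E).
  rewrite -/(iterate r o) /h (bigD1 (Ordinal rT))//= big1 => [|i ir].
    by rewrite /drawn Uo eqxx mul1r addr0 /gap addrC subrK.
  rewrite /drawn Uo eqr_nat (_ : (r == i) = false) ?mul0r//.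
  by apply/negbTE; apply: contra ir => /eqP e; apply/eqP/val_inj.
have idg := integrable_rv_sum (index_enum 'I_T) (fun r => (E_drawn_gap r).1).
have ih : integrable_rv P h by apply: integrable_rvD => //; exact: integrable_rv_cst.
rewrite -[LHS]fineK; last exact: integrable_fin_num ih.
congr (_%:E); rewrite -[LHS]/(\int[P]_o h o) /h RintegralD//; last exact: integrable_rv_cst.
rewrite Rintegral_prob_cst (Rintegral_sumr _ (fun r => (E_drawn_gap r).1)).
by congr (_ + _); rewrite /average_gap mulr_sumr; apply: eq_bigr => r _; rewrite (E_drawn_gap r).2.
Qed.

Lemma excess_risk_le B : 0 <= B -> (eta = 0 -> diam W = 0) ->
  (0 < eta -> diam W ^+ 2 / (2 * T%:R * eta) +
     eta / 2 * (2 * tau ^+ 2 + d%:R * s ^+ 2) + M / tau `^ (k - 1) * diam W <= B) ->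
  (\int[P]_o (f (dpsgd_output (fun i => grad (F i)) Pi w0
    (fun=> eta) b tau X N U o))%:E - (f u)%:E <= B%:E)%E.
Proof.
move=> B0 eta_diam boundB; rewrite expected_output -EFinB lee_fin addrC addKr.
have [eta_eq0|eta_neq0] := eqVneq eta 0.
  exact: le_trans (average_gap_diam0 (eta_diam eta_eq0)) B0.
have eta_gt0 : 0 < eta by rewrite lt_neqAle eq_sym eta_neq0.
exact: le_trans (average_gap_le eta_gt0) (boundB eta_gt0).
Qed.

End risk.

End dpsgd.

(** * Choice of the parameters *)

Section parameters.
Context {R : realType}.
Variables (T : nat) (D G k gamma phi tau eta v : R).
Hypotheses (D0 : 0 <= D) (G0 : 0 < G) (k1 : 1 < k) (gamma0 : 0 < gamma)
  (T1 : (1 <= T)%N).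
Let A := T%:R^-1 + phi ^+ 2.
Hypotheses (tauE : tau = G / gamma `^ k^-1 * A `^ (- (2 * k)^-1))
  (etaE : eta = D / (T%:R * tau) * A `^ (- 2^-1))
  (vE : v = T%:R * phi ^+ 2 * tau ^+ 2).

Let T_gt0 : 0 < T%:R :> R. Proof. by rewrite ltr0n. Qed.

Let A_gt0 : 0 < A.
Proof. by rewrite /A ltr_pwDl ?invr_gt0 ?sqr_ge0. Qed.

Let k_gt0 : 0 < k. Proof. exact: lt_trans k1. Qed.

Lemma clip_norm_gt0 : 0 < tau.
Proof. by rewrite tauE mulr_gt0 ?divr_gt0 ?powR_gt0. Qed.

Let q := A `^ 2^-1.

Let q_gt0 : 0 < q. Proof. exact: powR_gt0. Qed.

Let qq : q ^+ 2 = A.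
Proof. by rewrite /q powR12_sqrt ?sqr_sqrtr ?ltW. Qed.

Let tau_q : tau * q = G / gamma `^ k^-1 * A `^ (2^-1 * (1 - k^-1)).
Proof.
rewrite tauE -mulrA -powRD; last by rewrite (gt_eqF A_gt0) implybT.
by congr (_ * _ `^ _); field; rewrite gt_eqF.
Qed.

(** This is the equation [tau^k q = G^k / gamma] that determines [tau], divided by [tau^(k-1)]. *)
Let bias_q : G `^ k / gamma / tau `^ (k - 1) = tau * q.
Proof.
have t0 := clip_norm_gt0.
have powG : (G / gamma `^ k^-1) `^ k = G `^ k / gamma.
  rewrite powRM ?ltW ?invr_gt0 ?powR_gt0// -powRN -powRrM mulNr mulVf ?gt_eqF//.
  by rewrite powR_inv1 ?ltW.
have powA : (A `^ (- (2 * k)^-1)) `^ k * q = 1.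
  rewrite -powRrM -powRD; last by rewrite (gt_eqF A_gt0) implybT.
  by rewrite (_ : _ + _ = 0) ?powRr0//; field; rewrite gt_eqF.
have -> : G `^ k / gamma = tau * q * tau `^ (k - 1).
  rewrite mulrAC mulr_powRB1 ?(ltW t0)//.
  rewrite tauE powRM ?powR_ge0//; last by rewrite divr_ge0 ?powR_ge0 ?ltW.
  by rewrite powG -[RHS]mulrA powA mulr1.
by rewrite mulfK// gt_eqF// powR_gt0.
Qed.

Lemma risk_parameters : 0 < eta ->
  D ^+ 2 / (2 * T%:R * eta) + eta / 2 * (2 * tau ^+ 2 + v) +
    G `^ k / gamma / tau `^ (k - 1) * D <=
  5 * D * G / (2 * gamma `^ k^-1) * A `^ (2^-1 * (1 - k^-1)).
Proof.
move=> eta_gt0; have t0 := clip_norm_gt0.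
have etaq : eta = D / (T%:R * tau) / q by rewrite etaE powRN.
have Dn0 : D != 0.
  by apply: contraTneq eta_gt0 => D00; rewrite etaq D00 !mul0r ltxx.
have -> : 5 * D * G / (2 * gamma `^ k^-1) * A `^ (2^-1 * (1 - k^-1)) =
    5 / 2 * D * (tau * q).
  by rewrite tau_q; field; rewrite gt_eqF// powR_gt0.
rewrite bias_q.
have -> : D ^+ 2 / (2 * T%:R * eta) = D * (tau * q) / 2.
  by rewrite etaq; field; rewrite Dn0 !gt_eqF.
have : eta / 2 * (2 * tau ^+ 2 + v) <= D * (tau * q).
  (* Since [T q^2 = 1 + T phi^2], the factor on the right is [(2 + 2 T phi^2) tau^2], against the
     required [(2 + T phi^2) tau^2]. *)
  have -> : D * (tau * q) = eta / 2 * (2 * T%:R * q ^+ 2 * tau ^+ 2).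
    by rewrite etaq; field; rewrite !gt_eqF.
  apply: ler_wpM2l; first by rewrite divr_ge0// ltW.
  rewrite vE qq /A -mulrDl ler_wpM2r ?sqr_ge0//.
  have -> : 2 * T%:R * (T%:R^-1 + phi ^+ 2) = 2 + 2 * (T%:R * phi ^+ 2).
    by field; rewrite gt_eqF.
  by have : 0 <= T%:R * phi ^+ 2; [rewrite mulr_ge0 ?sqr_ge0// ltW|lra].
lra.
Qed.

Lemma risk_bound_ge0 :
  0 <= 5 * D * G / (2 * gamma `^ k^-1) * A `^ (2^-1 * (1 - k^-1)).
Proof.
by rewrite mulr_ge0 ?powR_ge0// divr_ge0 ?mulr_ge0 ?powR_ge0// ltW.
Qed.

Lemma step_size_ge0 : 0 <= eta.
Proof.
by rewrite etaE mulr_ge0 ?powR_ge0// divr_ge0// mulr_ge0// ltW// clip_norm_gt0.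
Qed.

Lemma step_size_eq0 : eta = 0 -> D = 0.
Proof.
move=> /eqP; rewrite etaE mulf_eq0 (gt_eqF (powR_gt0 _ A_gt0)) orbF.
rewrite mulf_eq0 invr_eq0 mulf_eq0 (gt_eqF T_gt0) (gt_eqF clip_norm_gt0) !orbF.
by move=> /eqP.
Qed.

Lemma risk_bound_special : 0 <= phi -> T%:R = (phi ^+ 2)^-1 ->
  5 * D * G / (2 * gamma `^ k^-1) * A `^ (2^-1 * (1 - k^-1)) =
  5 * D * G / (2 `^ (2^-1 * (1 + k^-1)) * gamma `^ k^-1) * phi `^ (1 - k^-1).
Proof.
move=> phi0 TE.
have -> : A = 2 * phi ^+ 2 by rewrite /A TE invrK mulr_natl mulr2n.
rewrite powRM ?sqr_ge0// -(powR_mulrn 2 phi0) -powRrM.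
have -> : 2 * (2^-1 * (1 - k^-1)) = 1 - k^-1 by field; rewrite gt_eqF.
(* Here [A = 2 phi^2]. Splitting the denominator 2 in this way lets its second factor cancel the
   power of 2 coming from [A]. *)
have two : 2 = 2 `^ (2^-1 * (1 + k^-1)) * 2 `^ (2^-1 * (1 - k^-1)) :> R.
  rewrite -powRD; last by rewrite pnatr_eq0 implybT.
  have -> : 2^-1 * (1 + k^-1) + 2^-1 * (1 - k^-1) = 1 by field; rewrite gt_eqF.
  by rewrite powRr1.
set a := 2 `^ _ in two *; set c := 2 `^ _ in two *.
rewrite [in LHS]two.
have a0 : 0 < a by exact: powR_gt0.
have c0 : 0 < c by exact: powR_gt0.
by field; rewrite !gt_eqF// powR_gt0.
Qed.

End parameters.

Theorem mainTheorem2
  (R : realType) (d n : nat)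
  (* data space, data distribution, loss *)
  (dZ : measure_display) (Zt : measurableType dZ) (D : probability Zt R)
  (loss : 'rV[R]_d -> Zt -> R)
  (* constraint set and DP-SGD ingredients *)
  (W : set 'rV[R]_d) (Pi : 'rV[R]_d -> 'rV[R]_d) (w0 : 'rV[R]_d)
  (Gf : Zt -> R) (G k : R)
  (eps delta nu b gamma : R) (T : nat)
  (phi tau eta sigma2 : R)
  (* random dataset Z = (z_1..z_n), i.i.d. from D *)
  (dO' : measure_display) (O' : measurableType dO') (P' : probability O' R)
  (Z : 'I_n -> O' -> Zt)
  (* algorithm's randomness *)
  (dO : measure_display) (O : measurableType dO) (P : probability O R)
  (X : nat -> 'I_n -> O -> R) (N : nat -> 'I_d -> O -> R) (U : O -> R) :
  (0 < n)%N ->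
  (* loss differentiable in w *)
  (forall z w, differentiable (fun w' => loss w' z) w) ->
  (* W bounded convex, projection, initial point *)
  convex_set (W : set (convex_lmodType 'rV[R]_d)) ->
  bounded_euclid W ->
  is_euclid_proj W Pi ->
  W w0 ->
  (* gradient envelope and its k-th moment *)
  (forall z, 0 <= Gf z) ->
  measurable_fun setT Gf ->
  (exists S, measurable S /\ D S = 1%E /\
     forall z, S z -> forall w, W w -> enorm (grad (fun w' => loss w' z) w) <= Gf z) ->
  1 < k -> 0 < G ->
  (((\int[D]_z ((Gf z) `^ k)%:E) `^ k^-1) <= G%:E)%E ->
  (* i.i.d. dataset *)
  mutually_independent P' Z ->
  (forall i A, measurable A -> P' (Z i @^-1` A) = D A) ->
  (* f convex (for every realization of the dataset) *)
  (forall o', convex_function (W : set (convex_lmodType 'rV[R]_d))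
     (fun w => n%:R^-1 * \sum_(i < n) loss w (Z i o'))) ->
  (* parameters *)
  0 < eps -> 0 < delta < 1 -> 0 < nu -> 1 <= b ->
  0 < gamma < 1 -> (1 <= T)%N ->
  phi = Num.sqrt (nu * d%:R * ln (delta^-1)) / (n%:R * eps) ->
  tau = G / gamma `^ k^-1 * (T%:R^-1 + phi ^+ 2) `^ (- (2 * k)^-1) ->
  eta = diam W / (T%:R * tau) * (T%:R^-1 + phi ^+ 2) `^ (- 2^-1) ->
  sigma2 = nu * T%:R * ln (delta^-1) * tau ^+ 2 / (n%:R ^+ 2 * eps ^+ 2) ->
  (* distribution of the algorithm's randomness *)
  mutually_independent P (@alg_family R dO O T n d X N U) ->
  (forall t i, (t < T)%N ->
     P (X t i @^-1` [set 1]) = (b / n%:R)%:E /\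
     P (X t i @^-1` [set 0]) = (1 - b / n%:R)%:E) ->
  (forall t j A, (t < T)%N -> measurable A ->
     P (N t j @^-1` A) = normal_prob 0 (Num.sqrt sigma2) A) ->
  (forall s, (s < T)%N -> P (U @^-1` [set s%:R]) = (T%:R^-1)%:E) ->
  let f o' := fun w => n%:R^-1 * \sum_(i < n) loss w (Z i o') in
  let wpriv o' := dpsgd_output
      (fun i => grad (fun w' => loss w' (Z i o'))) Pi w0 (fun _ => eta) b tau
      X N U in
  (exists E, measurable E /\ ((1 - gamma)%:E <= P' E)%E /\
     E `<=` [set o' | OR_le P W (f o') (wpriv o')
       (5 * diam W * G / (2 * gamma `^ k^-1) *
          (T%:R^-1 + phi ^+ 2) `^ (2^-1 * (1 - k^-1)))])
  /\
  (T%:R = (phi ^+ 2)^-1 ->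
   exists E, measurable E /\ ((1 - gamma)%:E <= P' E)%E /\
     E `<=` [set o' | OR_le P W (f o') (wpriv o')
       (5 * diam W * G / (2 `^ (2^-1 * (1 + k^-1)) * gamma `^ k^-1) *
          phi `^ (1 - k^-1))]).
Proof.
move=> n0 dloss Wconv Wbnd PiW Ww0 Gf0 mGf [S [mS [DS Senv]]] k1 G0 momG Zind Zlaw
  fconv eps0 /andP[delta0 delta1] nu0 b1 /andP[gamma0 gamma1] T1 phiE tauE etaE
  sigma2E algind Xlaw Nlaw Ulaw f wpriv.
have [E [mE PE Egood]] := good_event n0 Zind Zlaw mGf mS DS k1 G0 gamma0 momG.
have D0 : 0 <= diam W by apply: le_trans (le_diam Wbnd Ww0 Ww0); exact: enorm_ge0.
have tau0 : 0 < tau := clip_norm_gt0 G0 gamma0 T1 tauE.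
have lnd : 0 < ln delta^-1 by rewrite ln_gt0// invf_gt1.
have nR : 0 < n%:R :> R by rewrite ltr0n.
have TR : 0 < T%:R :> R by rewrite ltr0n.
(* Strict positivity makes the noise law nondegenerate, as the Gaussian moment lemmas require. *)
have sigma2_gt0 : 0 < sigma2.
  by rewrite sigma2E divr_gt0 ?mulr_gt0 ?exprn_gt0.
have noise : d%:R * sigma2 = T%:R * phi ^+ 2 * tau ^+ 2.
  rewrite phiE expr_div_n sqr_sqrtr; last by rewrite !mulr_ge0// ltW.
  by rewrite sigma2E; field; rewrite !gt_eqF.
pose bound := 5 * diam W * G / (2 * gamma `^ k^-1) *
  (T%:R^-1 + phi ^+ 2) `^ (2^-1 * (1 - k^-1)).
have risk o' : E o' -> OR_le P W (f o') (wpriv o') bound.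
  move=> /Egood[ZS Zmom] wstar Wws wsmin.
  have s0 : Num.sqrt sigma2 != 0 by rewrite gt_eqF// sqrtr_gt0.
  have dF (i : 'I_n) w : differentiable (fun w' => loss w' (Z i o')) w by exact: dloss.
  have GzF (i : 'I_n) w : W w -> enorm (grad (fun w' => loss w' (Z i o')) w) <= Gf (Z i o').
    by move=> Ww; exact: Senv (ZS i) w Ww.
  apply: (excess_risk_le n0 dF Wconv Wbnd PiW Ww0 Wws
    (step_size_ge0 D0 G0 gamma0 T1 tauE etaE) b1 tau0 s0 algind
    (fun t i tT => (Xlaw t i tT).1) Nlaw (fconv o') wsmin k1 GzF Zmom Ulaw T1).
  - exact: risk_bound_ge0.
  - exact: step_size_eq0 G0 gamma0 T1 tauE etaE.
  - move=> eta_gt0.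
    apply: (risk_parameters G0 k1 gamma0 T1 tauE etaE _ eta_gt0).
    by rewrite sqr_sqrtr ?noise// ltW.
have phi_ge0 : 0 <= phi by rewrite phiE divr_ge0// mulr_ge0// ltW.
split; first by exists E.
(* The same event works: for this [T] the two bounds are equal. *)
move=> TE; exists E; split=> //; split=> //.
by rewrite -(risk_bound_special (diam W) G k1 gamma0 phi_ge0 TE).
Qed.
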